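(* Let $k>0$, $c\in\mathbb{R}$, $x>0$, and let $\alpha,\beta,\eta,\lambda,v\in\mathbb{C}$ be such that $\Re(v)>-1$, $\Re(\alpha)>0$ and $\Re(\lambda+v)>\max[0,\Re(\beta-\eta)]$. Then $$\left(I_{0+}^{\alpha,\beta,\eta}\,t^{\frac{\lambda}{k}-1}W_{v,c}^{k}(t)\right)(x)=\frac{x^{\frac{\lambda}{k}+\frac{v}{k}-\beta-1}}{(2k)^{\frac{v}{k}}}\;{}_2\Psi_{3}\left[\begin{array}{c}\left(\frac{\lambda}{k}+\frac{v}{k},2\right),\left(\frac{\lambda}{k}+\frac{v}{k}+\eta-\beta,2\right)\\ \left(\frac{\lambda}{k}+\frac{v}{k}-\beta,2\right),\left(\frac{\lambda}{k}+\frac{v}{k}+\alpha+\eta,2\right),\left(\frac{v}{k}+1,1\right)\end{array};-\frac{cx^2}{4k}\right].$$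
   Context: Saigo's left-sided generalized fractional integral is defined for $x>0$, $\alpha,\beta,\eta\in\mathbb{C}$, $\Re(\alpha)>0$ by $$\left(I_{0+}^{\alpha,\beta,\eta}f\right)(x)=\frac{x^{-\alpha-\beta}}{\Gamma(\alpha)}\int_0^x (x-t)^{\alpha-1}\,{}_2F_1\left(\alpha+\beta,-\eta;\alpha;1-\tfrac{t}{x}\right)f(t)\,dt,$$ where ${}_2F_1(a,b;c;z)=\sum_{n\ge0}\frac{(a)_n(b)_n}{(c)_n}\frac{z^n}{n!}$ is the Gauss hypergeometric function and $(a)_n$ is the Pochhammer symbol. The notation $\left(I_{0+}^{\alpha,\beta,\eta}g(t)\right)(x)$ means the operator applied to the function $t\mapsto g(t)$ on $(0,\infty)$ and evaluated at $x$. The $k$-Bessel function is $$W_{v,c}^{k}(z)=\sum_{n=0}^{\infty}\frac{(-c)^n}{\Gamma_k(nk+v+k)\,n!}\left(\frac{z}{2}\right)^{2n+\frac{v}{k}},$$ where $\Gamma_k(z)=\int_0^\infty t^{z-1}e^{-t^k/k}\,dt$ for $\Re(z)>0$, extended by $\Gamma_k(z)=k^{\frac{z}{k}-1}\Gamma\left(\frac{z}{k}\right)$. The Wright type hypergeometric function is $${}_p\Psi_q\left[\begin{array}{c}(a_1,A_1),\dots,(a_p,A_p)\\(b_1,B_1),\dots,(b_q,B_q)\end{array};z\right]=\sum_{n=0}^\infty\frac{\Gamma(a_1+A_1n)\cdots\Gamma(a_p+A_pn)}{\Gamma(b_1+B_1n)\cdots\Gamma(b_q+B_qn)}\frac{z^n}{n!},$$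 with $A_i,B_j>0$ real and $1+\sum_j B_j-\sum_i A_i>0$. Reciprocals $1/\Gamma$ and $1/\Gamma_k$ are taken to be $0$ at the poles. Complex powers of positive reals are $y^s=e^{s\log y}$.
   Formalization: For k>1 the formal theorem also assumes Re(β-η) < Re((λ+v)/k); without it the integral can diverge at 0 (k=2, c=0, α=1, β=1/2, η=-1/2, v=0, λ=3/2). This also drops, for k>1, some exceptional parameters (η or -(α+β) a nonnegative integer) where it converges. *)

(* Defs.v *)
From HB Require Import structures.
From mathcomp Require Import all_boot all_order all_algebra.
From mathcomp Require Import complex.
From mathcomp Require Import all_classical all_reals all_analysis.

Set Implicit Arguments.
Unset Strict Implicit.
Unset Printing Implicit Defensive.

Import Order.TTheory GRing.Theory Num.Theory.
Import numFieldNormedType.Exports.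

Local Open Scope classical_set_scope.
Local Open Scope ring_scope.
Local Open Scope complex_scope.

Section ComplexAnalysis.
Context {R : realType}.

Definition cexp (z : R[i]) : R[i] :=
  (expR (complex.Re z) * cos (complex.Im z)) +i*
  (expR (complex.Re z) * sin (complex.Im z)).

(* Meaningful for y > 0 only. *)
Definition cpow (y : R) (s : R[i]) : R[i] := cexp (s * (ln y)%:C).

(* The topology used here is that of the regular module R[i]^o, whose balls are
   those of the complex modulus. *)
Definition csum (u : nat -> R[i]) : R[i] := limn (series u : nat -> R[i]^o).

Definition cintegrable (D : set R) (f : R -> R[i]) : Prop :=
  (@lebesgue_measure R).-integrable D (fun t => (complex.Re (f t))%:E) /\
  (@lebesgue_measure R).-integrable D (fun t => (complex.Im (f t))%:E).

Definition cintegral (D : set R) (f : R -> R[i]) : R[i] :=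
  (\int[@lebesgue_measure R]_(t in D) complex.Re (f t)) +i*
  (\int[@lebesgue_measure R]_(t in D) complex.Im (f t)).

Definition pochhammer (a : R[i]) (n : nat) : R[i] := \prod_(i < n) (a + i%:R).

Definition euler_integral (z : R[i]) : R[i] :=
  cintegral `]0, +oo[ (fun t => cpow t (z - 1) * (expR (- t))%:C).

(* Euler's integral for Re z > 0, continued to Re z <= 0 by
   Gamma(z) = Gamma(z + n) / (z)_n, where n is the least natural number such
   that Re (z + n) > 0.  At a pole (z)_n = 0, so that the value and its
   reciprocal are both 0, by the convention that 0^-1 = 0. *)
Definition cGamma (z : R[i]) : R[i] :=
  if 0 < complex.Re z then euler_integral z
  else let n := (Num.truncn (- complex.Re z)).+1 in
       euler_integral (z + n%:R) / pochhammer z n.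

Definition kGamma (k : R) (z : R[i]) : R[i] :=
  if 0 < complex.Re z then
    cintegral `]0, +oo[ (fun t => cpow t (z - 1) * (expR (- (t `^ k / k)))%:C)
  else cpow k (z / k%:C - 1) * cGamma (z / k%:C).

Definition hyp2F1 (a b c z : R[i]) : R[i] :=
  csum (fun n => pochhammer a n * pochhammer b n / pochhammer c n
                 * (z ^+ n / n`!%:R)).

(* Only real arguments z > 0, for which the power is defined by cpow. *)
Definition kBessel (k c : R) (v : R[i]) (z : R) : R[i] :=
  csum (fun n => (- c%:C) ^+ n
                 / (kGamma k (n%:R * k%:C + v + k%:C) * n`!%:R)
                 * cpow (z / 2) (2 * n%:R + v / k%:C)).

(* The pairs (a_i, A_i) and (b_j, B_j) are listed in s and r. *)
Definition wright_term (s r : seq (R[i] * R)) (z : R[i]) (n : nat) : R[i] :=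
  (\prod_(p <- s) cGamma (p.1 + p.2%:C * n%:R))
  / (\prod_(p <- r) cGamma (p.1 + p.2%:C * n%:R))
  * (z ^+ n / n`!%:R).

Definition wright (s r : seq (R[i] * R)) (z : R[i]) : R[i] :=
  csum (wright_term s r z).

Definition saigo_integrand (alpha beta eta : R[i]) (f : R -> R[i]) (x t : R)
    : R[i] :=
  cpow (x - t) (alpha - 1)
  * hyp2F1 (alpha + beta) (- eta) alpha (1 - t / x)%:C * f t.

(* Convergence of the integral defining [saigo]: without it the value of
   [saigo] is meaningless. *)
Definition saigo_converges (alpha beta eta : R[i]) (f : R -> R[i]) (x : R)
    : Prop :=
  cintegrable `]0, x[ (saigo_integrand alpha beta eta f x).

Definition saigo (alpha beta eta : R[i]) (f : R -> R[i]) (x : R) : R[i] :=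
  cpow x (- alpha - beta) / cGamma alpha
  * cintegral `]0, x[ (saigo_integrand alpha beta eta f x).

End ComplexAnalysis.

(* Main.v *)
Require Import Defs.
From HB Require Import structures.
From mathcomp Require Import all_boot all_order all_algebra.
From mathcomp Require Import complex ring lra.
From mathcomp Require Import all_classical all_reals all_analysis.
From mathcomp Require Import measurable_realfun.

Set Implicit Arguments.
Unset Strict Implicit.
Unset Printing Implicit Defensive.

Import Order.TTheory GRing.Theory Num.Theory.
Import numFieldNormedType.Exports.

Local Open Scope classical_set_scope.
Local Open Scope ring_scope.
Local Open Scope complex_scope.

(** The theorem follows by integrating two series term by term.

    Let [rho_n = lambda/k + v/k + 2n]. As [t^(lambda/k - 1) W(t)] is the sum
    over [n] of constants times [t^(rho_n - 1)], everything reduces to Saigo's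
    integral of one power [t^(rho - 1)] ([saigo_kernel_power]), and to the
    summability of these constants ([bessel_coef_le]), which rests on the
    boundedness of [1 / Gamma(v/k + 1 + n)]. The resulting series is the Wright
    series, because [Gamma_k(k w) = k^(w - 1) Gamma(w)] ([kGammaE]).

    For one power, the hypergeometric kernel is expanded in powers of
    [1 - t/x]. The terms integrate to Beta integrals, and their sum is a
    multiple of [2F1(alpha + beta, - eta; rho + alpha; 1)], which Gauss's
    theorem ([gauss_sum]) evaluates by Gamma values. The conditions
    [0 < Re rho] and [0 < Re (rho + eta - beta)] are those under which the Beta
    integrals and the Gauss series converge absolutely.

    Both classical evaluations come from one limit
    ([euler_limit_integral]): by dominated convergence,
    [n^p B(p, q + n)] tends to [Gamma(p)] for every [q]. Integration by parts
    computes [B(p, q + n)] from [B(p, q)] with Pochhammer symbols. For [q = 1]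
    this is Euler's limit [n! n^p / (p (p+1) ... (p+n))] of [Gamma(p)]. A
    convergent product bounds the reciprocal sequence, hence
    [Gamma(p) != 0], and the functional equation extends the limit of the
    reciprocals to the whole plane, poles included ([ccvg_euler_seq]). For
    general [q] it gives [B(p, q) = Gamma(p) Gamma(q) / Gamma(p + q)]. Gauss's
    theorem then follows from the contiguity relation between [c] and [c + 1],
    iterated to infinity, and Euler's limit also gives the growth of Pochhammer
    symbols that all the absolute convergence arguments need. *)

Import Normc.
Local Notation re := complex.Re.
Local Notation im := complex.Im.

(** * The modulus of a complex number *)

Section ComplexModulus.
Context {R : realType}.
Implicit Types (z w : R[i]) (x y : R).

Lemma reD z w : re (z + w) = re z + re w. Proof. by case: z w => ? ? []. Qed.
Lemma imD z w : im (z + w) = im z + im w. Proof. by case: z w => ? ? []. Qed.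
Lemma reN z : re (- z) = - re z. Proof. by case: z. Qed.
Lemma imN z : im (- z) = - im z. Proof. by case: z. Qed.
Lemma reB z w : re (z - w) = re z - re w. Proof. by rewrite reD reN. Qed.
Lemma imB z w : im (z - w) = im z - im w. Proof. by rewrite imD imN. Qed.
Lemma reM z w : re (z * w) = re z * re w - im z * im w.
Proof. by case: z w => ? ? []. Qed.
Lemma imM z w : im (z * w) = re z * im w + im z * re w.
Proof. by case: z w => ? ? []. Qed.
Lemma imC x : im x%:C = 0. Proof. by []. Qed.
Lemma reMr z x : re (z * x%:C) = re z * x.
Proof. by rewrite reM imC mulr0 subr0. Qed.
Lemma imMr z x : im (z * x%:C) = im z * x.
Proof. by rewrite imM imC mulr0 add0r. Qed.
Lemma natC n : (n%:R : R[i]) = (n%:R : R)%:C.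
Proof. by rewrite rmorph_nat. Qed.
Lemma re_nat n : re (n%:R : R[i]) = n%:R. Proof. by rewrite natC. Qed.
Lemma im_nat n : im (n%:R : R[i]) = 0. Proof. by rewrite natC. Qed.
Lemma re1 : re (1 : R[i]) = 1. Proof. by []. Qed.
Lemma im1 : im (1 : R[i]) = 0. Proof. by []. Qed.

Lemma eqC z w : re z = re w -> im z = im w -> z = w.
Proof. by case: z w => ? ? [? ?] /= -> ->. Qed.

Lemma re_sum I (r : seq I) (P : pred I) (F : I -> R[i]) :
  re (\sum_(i <- r | P i) F i) = \sum_(i <- r | P i) re (F i).
Proof. exact: (big_morph _ reD). Qed.
Lemma im_sum I (r : seq I) (P : pred I) (F : I -> R[i]) :
  im (\sum_(i <- r | P i) F i) = \sum_(i <- r | P i) im (F i).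
Proof. exact: (big_morph _ imD). Qed.

Lemma normc_ge0 z : 0 <= normc z. Proof. by case: z => ? ?; rewrite sqrtr_ge0. Qed.
Lemma normcD z w : normc (z + w) <= normc z + normc w.
Proof. exact: le_normcD. Qed.
Lemma normcB z w : normc (z - w) <= normc z + normc w.
Proof. by rewrite -(normcN w) normcD. Qed.
Lemma normcBC z w : normc (z - w) = normc (w - z).
Proof. by rewrite -normcN opprB. Qed.
Lemma normcC x : normc x%:C = `|x|.
Proof. by rewrite /= expr0n addr0 sqrtr_sqr. Qed.
Lemma normc_nat n : normc (n%:R : R[i]) = n%:R.
Proof. by rewrite natC normcC ger0_norm. Qed.
Lemma normcX z n : normc (z ^+ n) = normc z ^+ n.
Proof. by elim: n => [|n IH]; rewrite ?expr0 ?normc1// !exprS normcM IH. Qed.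
Lemma normc_eq0 z : (normc z == 0) = (z == 0).
Proof. by apply/eqP/eqP => [/eq0_normc//|->]; rewrite normc0. Qed.
Lemma normc_gt0 z : (0 < normc z) = (z != 0).
Proof. by rewrite lt_def normc_ge0 andbT normc_eq0. Qed.
Lemma normc_def2 z : normc z ^+ 2 = re z ^+ 2 + im z ^+ 2.
Proof. by case: z => a b /=; rewrite sqr_sqrtr// addr_ge0// sqr_ge0. Qed.
Lemma normc_re z : `|re z| <= normc z.
Proof.
by case: z => a b /=; rewrite -sqrtr_sqr ler_wsqrtr// lerDl sqr_ge0.
Qed.
Lemma normc_im z : `|im z| <= normc z.
Proof.
by case: z => a b /=; rewrite -sqrtr_sqr ler_wsqrtr// lerDr sqr_ge0.
Qed.
Lemma normc_le_reim z : normc z <= `|re z| + `|im z|.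
Proof.
case: z => a b /=.
rewrite -[leLHS]/(normc (a +i* b)) (complexE (a +i* b)).
apply: le_trans (normcD _ _) _; rewrite normcM !normcC.
suff -> : normc ('i : R[i]) = 1 by rewrite mul1r.
by rewrite /= expr0n add0r expr1n sqrtr1.
Qed.
Lemma normc_sum I (r : seq I) (P : pred I) (F : I -> R[i]) :
  normc (\sum_(i <- r | P i) F i) <= \sum_(i <- r | P i) normc (F i).
Proof.
elim/big_ind2 : _ => //; first by rewrite normc0.
by move=> a b c d ab cd; apply: le_trans (normcD _ _) (lerD ab cd).
Qed.
Lemma normc_div z w : normc (z / w) = normc z / normc w.
Proof. by rewrite normcM normcV. Qed.
End ComplexModulus.

(** * Convergence of complex sequences and series *)

Section ComplexSequences.
Context {R : realType}.
Implicit Types (u v : nat -> R[i]) (l m : R[i]).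

(** An inductive wrapper, so that unification matches sequences syntactically
    instead of unfolding the filters of [R[i]^o]. *)
Variant ccvg u l : Prop :=
  Ccvg of (u : nat -> R[i]^o) @ \oo --> (l : R[i]^o).

Lemma ccvg_dist0 u l :
  ccvg u l <-> (fun n => normc (u n - l)) @ \oo --> (0 : R).
Proof.
split=> [[/cvgrPdist_lt H]|/cvgrPdist_lt H]; [|constructor];
  apply/cvgrPdist_lt => e e0.
  have /H : 0 < e%:C by rewrite ltcR.
  apply: filterS => n; rewrite ltcR sub0r normrN ger0_norm ?normc_ge0//.
  by rewrite normcBC.
have re0 : 0 < re e by move: e0; rewrite ltcE => /andP[].
have ree : e = (re e)%:C by rewrite RRe_real// gtr0_real.
have := H _ re0; apply: filterS => n.
rewrite sub0r normrN ger0_norm ?normc_ge0// => h.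
by rewrite ree ltcR normcBC.
Qed.

Lemma ccvg_squeeze u l (v : nat -> R) :
  (\forall n \near \oo, normc (u n - l) <= v n) -> v @ \oo --> (0 : R) ->
  ccvg u l.
Proof.
move=> uv v0; apply/ccvg_dist0.
apply: (squeeze_cvgr _ (cvg_cst 0) v0).
by apply: filterS uv => n; rewrite normc_ge0.
Qed.

Lemma ccvg_re u l : ccvg u l -> (fun n => re (u n)) @ \oo --> re l.
Proof.
move=> /ccvg_dist0 H; apply/subr_cvg0.
apply/cvgr0Pnorm_lt => e e0; move/cvgr0Pnorm_lt : H => /(_ e e0).
apply: filterS => n; rewrite ger0_norm ?normc_ge0//.
by apply: le_lt_trans; rewrite -reB normc_re.
Qed.

Lemma ccvg_im u l : ccvg u l -> (fun n => im (u n)) @ \oo --> im l.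
Proof.
move=> /ccvg_dist0 H; apply/subr_cvg0.
apply/cvgr0Pnorm_lt => e e0; move/cvgr0Pnorm_lt : H => /(_ e e0).
apply: filterS => n; rewrite ger0_norm ?normc_ge0//.
by apply: le_lt_trans; rewrite -imB normc_im.
Qed.

Lemma ccvg_reim u l : (fun n => re (u n)) @ \oo --> re l ->
  (fun n => im (u n)) @ \oo --> im l -> ccvg u l.
Proof.
move=> /subr_cvg0/cvg_norm + /subr_cvg0/cvg_norm; rewrite normr0 => hr hi.
apply: (@ccvg_squeeze _ _ (fun n => `|re (u n) - re l| + `|im (u n) - im l|)).
  by apply: nearW => n; rewrite -reB -imB normc_le_reim.
by rewrite -(addr0 (0 : R)); exact: cvgD.
Qed.

Lemma ccvg_real (u : nat -> R) (l : R) : u @ \oo --> l ->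
  ccvg (fun n => (u n)%:C) l%:C.
Proof.
by move=> ul; apply: ccvg_reim => //=; exact: cvg_cst.
Qed.

Lemma ccvg_normc u l : ccvg u l -> (fun n => normc (u n)) @ \oo --> normc l.
Proof.
move=> ul; have h := ccvg_re ul; have k := ccvg_im ul.
have e z : normc z = Num.sqrt (re z * re z + im z * im z).
  by case: z => a b; rewrite -!expr2.
rewrite e (_ : (fun n => normc (u n)) = Num.sqrt \o
  (fun n => re (u n) * re (u n) + im (u n) * im (u n))); last first.
  by apply/funext => n; rewrite e.
exact: (cvg_comp _ _ (cvgD (cvgM h h) (cvgM k k)) (@sqrt_continuous R _)).
Qed.

Lemma ccvg_cst (c : R[i]) : ccvg (fun=> c) c.
Proof. by apply: ccvg_reim; exact: cvg_cst. Qed.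

Lemma ccvgD u v l m : ccvg u l -> ccvg v m -> ccvg (fun n => u n + v n) (l + m).
Proof.
move=> cu cv; apply: ccvg_reim.
  rewrite reD; under eq_fun do rewrite reD.
  exact: (cvgD (ccvg_re cu) (ccvg_re cv)).
rewrite imD; under eq_fun do rewrite imD.
exact: (cvgD (ccvg_im cu) (ccvg_im cv)).
Qed.

Lemma ccvgM u v l m : ccvg u l -> ccvg v m -> ccvg (fun n => u n * v n) (l * m).
Proof.
move=> cu cv; apply: ccvg_reim.
  rewrite reM; under eq_fun do rewrite reM.
  exact: (cvgB (cvgM (ccvg_re cu) (ccvg_re cv))
               (cvgM (ccvg_im cu) (ccvg_im cv))).
rewrite imM; under eq_fun do rewrite imM.
exact: (cvgD (cvgM (ccvg_re cu) (ccvg_im cv))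
             (cvgM (ccvg_im cu) (ccvg_re cv))).
Qed.

Lemma ccvgZ (c : R[i]) u l : ccvg u l -> ccvg (fun n => c * u n) (c * l).
Proof. by move=> cu; apply: ccvgM => //; exact: ccvg_cst. Qed.

Lemma ccvgB u v l m : ccvg u l -> ccvg v m -> ccvg (fun n => u n - v n) (l - m).
Proof.
move=> cu cv; rewrite -mulN1r.
rewrite (_ : (fun n => u n - v n) = (fun n => u n + (-1) * v n)).
  by apply: ccvgD => //; exact: ccvgZ.
by apply/funext => n; rewrite mulN1r.
Qed.

Lemma ccvgV u l : l != 0 -> ccvg u l -> ccvg (fun n => (u n)^-1) l^-1.
Proof. by move=> l0 [cu]; constructor; apply: (@cvgV R[i]). Qed.

Lemma ccvg_unique u l m : ccvg u l -> ccvg u m -> l = m.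
Proof.
move=> ul um; apply: eqC.
  exact: (cvg_unique _ (ccvg_re ul) (ccvg_re um)).
exact: (cvg_unique _ (ccvg_im ul) (ccvg_im um)).
Qed.

Lemma ccvg_near u v l : (\forall n \near \oo, u n = v n) -> ccvg v l -> ccvg u l.
Proof.
move=> uv /ccvg_dist0 vl; apply/ccvg_dist0; apply: cvg_trans vl.
by apply: near_eq_cvg; apply: filterS uv => n ->.
Qed.

Lemma ccvg_shift k u l : ccvg (fun n => u (n + k)%N) l <-> ccvg u l.
Proof.
rewrite !ccvg_dist0.
by have -> := cvg_shiftn k (fun n => normc (u n - l)) (nbhs (0 : R)).
Qed.

Lemma csumE u l : ccvg (series u) l -> csum u = l.
Proof.
by move=> [ul]; apply: (@cvg_lim R[i]^o) => //; exact: norm_hausdorff.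
Qed.

Lemma re_series u n : re (series u n) = series (fun k => re (u k)) n.
Proof. by rewrite /series /= re_sum. Qed.
Lemma im_series u n : im (series u n) = series (fun k => im (u k)) n.
Proof. by rewrite /series /= im_sum. Qed.

(** The modulus dominates both coordinates, so that each of the two real series
    converges absolutely. *)
Lemma normc_series_cvg u :
  cvgn (series (fun n => normc (u n))) -> ccvg (series u) (csum u).
Proof.
move=> cu.
have cr : cvgn (series (fun n => re (u n))).
  apply: normed_cvg; apply: series_le_cvg cu => n //=; first exact: normc_ge0.
  exact: normc_re.
have ci : cvgn (series (fun n => im (u n))).
  apply: normed_cvg; apply: series_le_cvg cu => n //=; first exact: normc_ge0.
  exact: normc_im.
have H : ccvg (series u) (limn (series (fun n => re (u n))) +i*
                          limn (series (fun n => im (u n)))).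
  apply: ccvg_reim => /=.
  - by under eq_fun do rewrite re_series; exact: cr.
  - by under eq_fun do rewrite im_series; exact: ci.
by rewrite (csumE H).
Qed.

Lemma nneg_series_cvg (u : nat -> R) (M : R) : (forall n, 0 <= u n) ->
  (forall n, series u n <= M) -> cvgn (series u).
Proof.
move=> u0 uM; apply: nondecreasing_is_cvgn.
  by apply/nondecreasing_series => n _ _; exact: u0.
by exists M => _ [n _ <-].
Qed.

End ComplexSequences.

(** * The exponential and complex powers of positive reals *)

Section ComplexExponential.
Context {R : realType}.
Implicit Types (s t z w : R[i]) (x y : R).

Lemma cexpD z w : cexp (z + w) = cexp z * cexp w.
Proof.
apply: eqC; rewrite ?reM ?imM /cexp /= !(reD, imD) expRD ?cosD ?sinD.
  by rewrite mulrBr; congr (_ - _); rewrite mulrACA.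
by rewrite mulrDr addrC; congr (_ + _); rewrite mulrACA.
Qed.

Lemma cexpC x : cexp x%:C = (expR x)%:C.
Proof. by rewrite /cexp /= cos0 sin0 mulr1 mulr0. Qed.

Lemma cexp0 : cexp 0 = 1 :> R[i].
Proof. by rewrite cexpC expR0. Qed.

Lemma normc_cexp z : normc (cexp z) = expR (re z).
Proof.
by rewrite /cexp /= !exprMn -mulrDr cos2Dsin2 mulr1 sqrtr_sqr ger0_norm.
Qed.

Lemma cexp_neq0 z : cexp z != 0.
Proof. by rewrite -normc_eq0 normc_cexp expR_eq0. Qed.

Lemma cexpN z : cexp (- z) = (cexp z)^-1.
Proof.
by apply: (mulfI (cexp_neq0 z)); rewrite -cexpD subrr cexp0 divff// cexp_neq0.
Qed.

Lemma ccvg_cexp (u : nat -> R[i]) (l : R[i]) : ccvg u l ->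
  ccvg (fun n => cexp (u n)) (cexp l).
Proof.
move=> ul; have [hr hi] := (ccvg_re ul, ccvg_im ul).
have er := cvg_comp _ _ hr (@continuous_expR R (re l)).
have ci := cvg_comp _ _ hi (@continuous_cos R (im l)).
have si := cvg_comp _ _ hi (@continuous_sin R (im l)).
by apply: ccvg_reim => /=; [exact: cvgM er ci|exact: cvgM er si].
Qed.

Lemma cpowD y s t : cpow y (s + t) = cpow y s * cpow y t.
Proof. by rewrite /cpow mulrDl cexpD. Qed.

Lemma cpow0 y : cpow y 0 = 1 :> R[i].
Proof. by rewrite /cpow mul0r cexp0. Qed.

Lemma cpow_neq0 y s : cpow y s != 0. Proof. exact: cexp_neq0. Qed.

Lemma cpowN y s : cpow y (- s) = (cpow y s)^-1.
Proof. by rewrite /cpow mulNr cexpN. Qed.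

Lemma cpowB y s t : cpow y (s - t) = cpow y s / cpow y t.
Proof. by rewrite cpowD cpowN. Qed.

Lemma cpow_real y x : 0 < y -> cpow y x%:C = (y `^ x)%:C.
Proof. by move=> y0; rewrite /cpow -rmorphM cexpC /powR gt_eqF. Qed.

Lemma cpow_nat y n : 0 < y -> cpow y n%:R = (y ^+ n)%:C.
Proof. by move=> y0; rewrite natC cpow_real// powR_mulrn// ltW. Qed.

Lemma cpowr1 y : 0 < y -> cpow y 1 = y%:C.
Proof. by move=> y0; rewrite (cpow_nat 1)// expr1. Qed.

Lemma cpow1r s : cpow 1 s = 1.
Proof. by rewrite /cpow ln1 mulr0 cexp0. Qed.

Lemma cpowM x y s : 0 < x -> 0 < y -> cpow (x * y) s = cpow x s * cpow y s.
Proof. by move=> x0 y0; rewrite /cpow lnM// rmorphD mulrDr cexpD. Qed.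

Lemma cpowV y s : 0 < y -> cpow y^-1 s = (cpow y s)^-1.
Proof. by move=> y0; rewrite /cpow lnV// rmorphN mulrN cexpN. Qed.

Lemma cpow_div x y s : 0 < x -> 0 < y -> cpow (x / y) s = cpow x s / cpow y s.
Proof. by move=> x0 y0; rewrite cpowM ?invr_gt0// cpowV. Qed.

Lemma cpow_powR y x s : 0 < y -> cpow (y `^ x) s = cpow y (s * x%:C).
Proof.
by move=> y0; rewrite /cpow ln_powR rmorphM mulrA.
Qed.

Lemma normc_cpow y s : 0 < y -> normc (cpow y s) = y `^ (re s).
Proof. by move=> y0; rewrite normc_cexp reMr /powR gt_eqF. Qed.

End ComplexExponential.

Arguments cpow : simpl never.
Arguments cexp : simpl never.
Arguments normc : simpl never.

(** * Complex functions of a real variable *)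

Section ComplexDerivative.
Context {R : realType}.
Implicit Types (f g : R -> R[i]) (x t : R).

(** Coordinatewise, since the functions of [R] with values in [R[i]] are
    integrated coordinatewise as well. *)
Definition is_cderive f t (d : R[i]) :=
  is_derive t (1 : R) (fun u => re (f u)) (re d) /\
  is_derive t (1 : R) (fun u => im (f u)) (im d).

Definition ccontinuous f t :=
  {for t, continuous (fun u => re (f u))} /\
  {for t, continuous (fun u => im (f u))}.

Lemma is_cderive_continuous f t d : is_cderive f t d -> ccontinuous f t.
Proof.
by move=> [[h _] [k _]]; split;
  apply: differentiable_continuous; exact/derivable1_diffP.
Qed.

Lemma is_cderiveM f g t a b : is_cderive f t a -> is_cderive g t b ->
  is_cderive (fun u => f u * g u) t (a * g t + f t * b).
Proof.
move=> [fr fi] [gr gi]; split.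
  under eq_fun do rewrite reM.
  apply: (is_derive_eq (is_deriveB (is_deriveM fr gr) (is_deriveM fi gi))).
  rewrite !(reD, reM) /GRing.scale /=; ring.
under eq_fun do rewrite imM.
apply: (is_derive_eq (is_deriveD (is_deriveM fr gi) (is_deriveM fi gr))).
rewrite !(imD, imM) /GRing.scale /=; ring.
Qed.

Lemma ccontinuousM f g t : ccontinuous f t -> ccontinuous g t ->
  ccontinuous (fun u => f u * g u) t.
Proof.
move=> [fr fi] [gr gi]; split.
  rewrite (_ : (fun u => re (f u * g u)) =
    (fun u => re (f u) * re (g u) - im (f u) * im (g u))); last first.
    by apply/funext => u; rewrite reM.
  by apply: cvgB; apply: cvgM; [exact: fr|exact: gr|exact: fi|exact: gi].
rewrite (_ : (fun u => im (f u * g u)) =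
  (fun u => re (f u) * im (g u) + im (f u) * re (g u))); last first.
  by apply/funext => u; rewrite imM.
by apply: cvgD; apply: cvgM; [exact: fr|exact: gi|exact: fi|exact: gr].
Qed.

Lemma ccontinuousD f g t : ccontinuous f t -> ccontinuous g t ->
  ccontinuous (fun u => f u + g u) t.
Proof.
move=> [fr fi] [gr gi]; split.
  rewrite (_ : (fun u => re (f u + g u)) = (fun u => re (f u) + re (g u))).
    by apply: cvgD; [exact: fr|exact: gr].
  by apply/funext => u; rewrite reD.
rewrite (_ : (fun u => im (f u + g u)) = (fun u => im (f u) + im (g u))).
  by apply: cvgD; [exact: fi|exact: gi].
by apply/funext => u; rewrite imD.
Qed.

Lemma ccontinuousZ (c : R[i]) f t : ccontinuous f t ->
  ccontinuous (fun u => c * f u) t.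
Proof.
by move=> cf; apply: ccontinuousM => //; split; exact: cvg_cst.
Qed.

Lemma ccontinuousC (f : R -> R) t : {for t, continuous f} ->
  ccontinuous (fun u => (f u)%:C) t.
Proof. by move=> cf; split => //=; exact: cvg_cst. Qed.

Lemma is_cderive_comp f (h : R -> R) t (d : R[i]) (e : R) :
  is_cderive f (h t) d -> is_derive t (1 : R) h e ->
  is_cderive (fun u => f (h u)) t (d * e%:C).
Proof.
move=> [fr fi] he; split.
  by apply: (is_derive_eq (is_derive1_comp fr he)); rewrite reMr mulrC.
by apply: (is_derive_eq (is_derive1_comp fi he)); rewrite imMr mulrC.
Qed.

Lemma is_cderive_eq f t a b : is_cderive f t a -> a = b -> is_cderive f t b.
Proof. by move=> + <-. Qed.

Lemma is_cderive_cpow s t : 0 < t ->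
  is_cderive (fun u => cpow u s) t (s * cpow t (s - 1)).
Proof.
move=> t0.
have dln (c : R) : is_derive t (1 : R) (fun u => c * ln u) (c * t^-1).
  exact: (is_deriveZ c (is_derive1_ln t0)).
have dexp (c : R) :
    is_derive t (1 : R) (fun u => expR (c * ln u)) (c * t^-1 * expR (c * ln t)).
  have := @is_derive1_comp _ expR (fun u => c * ln u) t _ _ (is_derive_expR (c * ln t)) (dln c).
  by move=> h; apply: (is_derive_eq h); rewrite mulrC.
have dcos (c : R) :
    is_derive t (1 : R) (fun u => cos (c * ln u)) (- (c * t^-1 * sin (c * ln t))).
  have := @is_derive1_comp _ cos (fun u => c * ln u) t _ _ (is_derive_cos (c * ln t)) (dln c).
  by move=> h; apply: (is_derive_eq h); rewrite -mulNr mulrC mulrN mulNr.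
have dsin (c : R) :
    is_derive t (1 : R) (fun u => sin (c * ln u)) (c * t^-1 * cos (c * ln t)).
  have := @is_derive1_comp _ sin (fun u => c * ln u) t _ _ (is_derive_sin (c * ln t)) (dln c).
  by move=> h; apply: (is_derive_eq h); rewrite mulrC.
have -> : s * cpow t (s - 1) = s * (t^-1)%:C * cpow t s.
  by rewrite cpowB cpowr1// fmorphV mulrA mulrAC.
split.
- rewrite /cpow /cexp /=; under eq_fun do rewrite reMr imMr.
  apply: (is_derive_eq (is_deriveM (dexp _) (dcos _))).
  rewrite reM reMr imMr /= reMr imMr /GRing.scale /=; ring.
- rewrite /cpow /cexp /=; under eq_fun do rewrite reMr imMr.
  apply: (is_derive_eq (is_deriveM (dexp _) (dsin _))).
  rewrite imM reMr imMr /= reMr imMr /GRing.scale /=; ring.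
Qed.

End ComplexDerivative.


(** * Integration of complex functions *)

Section ComplexIntegral.
Context {R : realType}.
Local Notation mu := (@lebesgue_measure R).
Local Notation mR := (measurableTypeR R).
Implicit Types (D : set mR) (f g : R -> R[i]) (c : R[i]).

Definition cmeasurable D f := measurable_fun D (fun t : mR => re (f t)) /\
  measurable_fun D (fun t : mR => im (f t)).

Lemma open_ccontinuous_cmeasurable D f : open D ->
  (forall t, D t -> ccontinuous f t) -> cmeasurable D f.
Proof.
move=> oD cf; split; apply: open_continuous_measurable_fun => // t /set_mem Dt;
  by have [] := cf t Dt.
Qed.

Lemma cmeasurable_normc D f : cmeasurable D f ->
  measurable_fun D (fun t : mR => normc (f t)).
Proof.
move=> [mr mi].
rewrite (_ : (fun t => normc (f t)) =
  Num.sqrt \o (fun t => re (f t) ^+ 2 + im (f t) ^+ 2)); last first.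
  by apply/funext => t /=; case: (f t).
apply: measurableT_comp.
  by apply: continuous_measurable_fun; exact: sqrt_continuous.
by apply: measurable_funD; apply: measurable_funX.
Qed.

Lemma cintegrable_cmeasurable D f : cintegrable D f -> cmeasurable D f.
Proof.
by move=> [/measurable_int/measurable_EFinP ? /measurable_int/measurable_EFinP ?].
Qed.

Lemma cintegrable_le D f (g : R -> R) : measurable D -> cmeasurable D f ->
  mu.-integrable D (EFin \o g) -> (forall t, D t -> normc (f t) <= g t) ->
  cintegrable D f.
Proof.
move=> mD [mr mi] ig fg.
split; (apply: (le_integrable mD _ _ ig); first exact/measurable_EFinP);
  move=> t Dt /=; rewrite lee_fin; apply: (le_trans _ (ler_norm _));
  apply: (le_trans _ (fg _ Dt)); [exact: normc_re|exact: normc_im].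
Qed.

Lemma cintegrable_normc D f : measurable D -> cintegrable D f ->
  mu.-integrable D (fun t => (normc (f t))%:E).
Proof.
move=> mD [ir ii].
have := integrableD mD (integrable_abse ir) (integrable_abse ii).
apply: (le_integrable mD).
  apply/measurable_EFinP; apply: cmeasurable_normc.
  exact: cintegrable_cmeasurable.
move=> t Dt /=; rewrite lee_fin (ger0_norm (normc_ge0 _)).
by apply: (le_trans _ (ler_norm _)); exact: normc_le_reim.
Qed.

Lemma cintegrableZ D c f : measurable D -> cintegrable D f ->
  cintegrable D (fun t => c * f t).
Proof.
move=> mD [ir ii]; split.
  have := integrableB mD (integrableZl mD (re c) ir) (integrableZl mD (im c) ii).
  by apply: eq_integrable => // t _ /=; rewrite reM EFinB !EFinM.
have := integrableD mD (integrableZl mD (re c) ii) (integrableZl mD (im c) ir).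
by apply: eq_integrable => // t _ /=; rewrite imM EFinD !EFinM.
Qed.

Lemma cintegralZ D c f : measurable D -> cintegrable D f ->
  cintegral D (fun t => c * f t) = c * cintegral D f.
Proof.
move=> mD [ir ii].
have iZ (x : R) (h : mR -> R) : mu.-integrable D (fun t => (h t)%:E) ->
    mu.-integrable D (EFin \o (fun t => x * h t)).
  by move=> ih; exact: (integrableZl mD x ih).
apply: eqC; rewrite ?reM ?imM /=.
  under eq_Rintegral do rewrite reM.
  rewrite RintegralB ?RintegralZl//; exact: iZ.
under eq_Rintegral do rewrite imM.
by rewrite RintegralD ?RintegralZl//; exact: iZ.
Qed.

Lemma cintegrableD D f g : measurable D -> cintegrable D f -> cintegrable D g ->
  cintegrable D (fun t => f t + g t).
Proof.
move=> mD [fr fi] [gr gi]; split.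
  have := integrableD mD fr gr.
  by apply: eq_integrable => // t _ /=; rewrite reD EFinD.
have := integrableD mD fi gi.
by apply: eq_integrable => // t _ /=; rewrite imD EFinD.
Qed.

Lemma cintegralD D f g : measurable D -> cintegrable D f -> cintegrable D g ->
  cintegral D (fun t => f t + g t) = cintegral D f + cintegral D g.
Proof.
move=> mD [fr fi] [gr gi]; apply: eqC; rewrite ?reD ?imD /=.
  by under eq_Rintegral do rewrite reD; rewrite RintegralD.
by under eq_Rintegral do rewrite imD; rewrite RintegralD.
Qed.

Lemma eq_cintegral D f g : {in D, f =1 g} -> cintegral D f = cintegral D g.
Proof.
by move=> fg; apply: eqC => /=; apply: eq_Rintegral => t Dt; rewrite fg.
Qed.

Lemma cintegrable0 D : measurable D -> cintegrable D (fun=> 0 : R[i]).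
Proof. by move=> mD; split; exact: integrable0. Qed.

Lemma cintegral0 D : cintegral D (fun=> 0 : R[i]) = 0.
Proof. by rewrite /cintegral /Rintegral integral0. Qed.

Lemma cintegrable_sum D (f : nat -> R -> R[i]) n : measurable D ->
  (forall k, cintegrable D (f k)) ->
  cintegrable D (fun t => \sum_(0 <= k < n) f k t).
Proof.
move=> mD fi; elim: n => [|n IH].
  by under eq_fun do rewrite big_nil; exact: cintegrable0.
by under eq_fun do rewrite big_nat_recr//=; exact: cintegrableD.
Qed.

Lemma cintegral_sum D (f : nat -> R -> R[i]) n : measurable D ->
  (forall k, cintegrable D (f k)) ->
  cintegral D (fun t => \sum_(0 <= k < n) f k t) =
  \sum_(0 <= k < n) cintegral D (f k).
Proof.
move=> mD fi; elim: n => [|n IH].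
  by under eq_fun do rewrite big_nil; rewrite big_nil cintegral0.
under eq_fun do rewrite big_nat_recr//=.
by rewrite big_nat_recr//= cintegralD ?IH//; exact: cintegrable_sum.
Qed.

(** The bound [g] takes extended real values, because a sum of moduli may be
    infinite on a null set. *)
Lemma real_dominated_convergence D (f_ : nat -> R -> R) (f : R -> R)
    (g : R -> \bar R) : measurable D ->
  (forall n, measurable_fun D (f_ n)) ->
  (forall t, D t -> (fun n => f_ n t) @ \oo --> f t) ->
  mu.-integrable D g -> (forall n t, D t -> (`|f_ n t|%:E <= g t)%E) ->
  mu.-integrable D (EFin \o f) /\
  (fun n => \int[mu]_(t in D) f_ n t) @ \oo --> \int[mu]_(t in D) f t.
Proof.
move=> mD mf_ cf ig fg.
have mf : measurable_fun D f by exact: measurable_fun_cvg mf_ cf.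
have [|||||fi _ cv] := @dominated_convergence _ _ R mu D mD
    (fun n => EFin \o f_ n) (EFin \o f) g.
- by move=> n; apply/measurable_EFinP.
- exact/measurable_EFinP.
- by apply/aeW => t Dt; apply: cvg_EFin; [exact: nearW|exact: cf].
- exact: ig.
- by apply/aeW => t n Dt /=; exact: fg.
- split => //.
  have fin : (\int[mu]_(t in D) (EFin \o f) t)%E \is a fin_num.
    exact: integrable_fin_num.
  by move: cv; rewrite -[X in _ --> X -> _]fineK// => /fine_cvgP[_].
Qed.

Lemma cdominated_convergence D (f_ : nat -> R -> R[i]) f (g : R -> \bar R) :
  measurable D -> (forall n, cmeasurable D (f_ n)) ->
  (forall t, D t -> ccvg (fun n => f_ n t) (f t)) ->
  mu.-integrable D g -> (forall n t, D t -> ((normc (f_ n t))%:E <= g t)%E) ->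
  cintegrable D f /\
  ccvg (fun n => cintegral D (f_ n)) (cintegral D f).
Proof.
move=> mD mf_ cf ig fg.
have lee_fin' (x y : R) : x <= y -> (x%:E <= y%:E)%E by rewrite lee_fin.
have [ir cr] := @real_dominated_convergence D (fun n t => re (f_ n t))
  (fun t => re (f t)) g mD (fun n => (mf_ n).1)
  (fun t Dt => ccvg_re (cf t Dt)) ig
  (fun n t Dt => le_trans (lee_fin' _ _ (normc_re (f_ n t))) (fg n t Dt)).
have [ii ci] := @real_dominated_convergence D (fun n t => im (f_ n t))
  (fun t => im (f t)) g mD (fun n => (mf_ n).2)
  (fun t Dt => ccvg_im (cf t Dt)) ig
  (fun n t Dt => le_trans (lee_fin' _ _ (normc_im (f_ n t))) (fg n t Dt)).
by split=> //; apply: ccvg_reim.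
Qed.

(** The partial sums are dominated by the sum of all the moduli, and [M] bounds
    the integral of that sum by monotone convergence. *)
Lemma cintegral_series D (f : nat -> R -> R[i]) (F : R -> R[i]) (M : R) : measurable D ->
  (forall n, cintegrable D (f n)) ->
  (forall n, \sum_(0 <= k < n) \int[mu]_(t in D) normc (f k t) <= M) ->
  (forall t, D t -> ccvg (series (fun n => f n t)) (F t)) ->
  cintegrable D F /\
  ccvg (series (fun n => cintegral D (f n))) (cintegral D F).
Proof.
move=> mD fi fM cF.
pose g t := (\sum_(k <oo) (normc (f k t))%:E)%E.
have mn k : measurable_fun D (fun t : mR => (normc (f k t))%:E).
  apply/measurable_EFinP; apply: cmeasurable_normc.
  exact: cintegrable_cmeasurable.
have n0 k t : (0 <= (normc (f k t))%:E)%E by rewrite lee_fin normc_ge0.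
have ig : mu.-integrable D g.
  apply/integrableP; split.
    by apply: (@ge0_emeasurable_sum _ _ _ D _ xpredT).
  under eq_integral do rewrite gee0_abs ?nneseries_ge0//.
  rewrite integral_nneseries//.
  apply: (@le_lt_trans _ _ M%:E); last exact: ltry.
  apply: lime_le.
    by apply: is_cvg_nneseries => n _ _; apply: integral_ge0.
  apply: nearW => n.
  apply: le_trans (_ : (\sum_(0 <= k < n) \int[mu]_(t in D) normc (f k t))%:E <= _)%E; last first.
    by rewrite lee_fin.
  rewrite -sumEFin; apply: lee_sum => k _.
  by rewrite fineK//; apply: integrable_fin_num => //; exact: cintegrable_normc.
have [] := @cdominated_convergence D (fun n t => \sum_(0 <= k < n) f k t) F g mD.
- by move=> n; apply: cintegrable_cmeasurable; exact: cintegrable_sum.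
- exact: cF.
- exact: ig.
- move=> n t Dt; apply: (@le_trans _ _ (\sum_(0 <= k < n) (normc (f k t))%:E)%E).
    by rewrite sumEFin lee_fin; exact: normc_sum.
  exact: nneseries_lim_ge.
move=> iF cv; split => //; move: cv.
by under eq_fun do rewrite cintegral_sum//.
Qed.

End ComplexIntegral.

(** * Improper integrals by exhaustion *)

Section Exhaustion.
Context {R : realType}.
Local Notation mu := (@lebesgue_measure R).
Local Notation mR := (measurableTypeR R).
Implicit Types (D : set mR) (a b : nat -> R).

(** Improper integrals over an open interval [D] are studied through an
    increasing sequence of segments with union [D]: on each segment the
    integrands below have no singularity. *)
Definition exhausts D a b := [/\ forall n, a n < b n,
  forall m n, (m <= n)%N -> a n <= a m,
  forall m n, (m <= n)%N -> b m <= b n &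
  D = \bigcup_n `[a n, b n]%classic].

Lemma exhausts_nd D a b : exhausts D a b ->
  nondecreasing_seq (fun n => `[a n, b n]%classic).
Proof.
move=> [_ ha hb _] m n mn; apply/subsetPset => t /=.
rewrite !in_itv /= => /andP[h1 h2].
by rewrite (le_trans (ha _ _ mn) h1) (le_trans h2 (hb _ _ mn)).
Qed.

Lemma exhausts_measurable D a b : exhausts D a b -> measurable D.
Proof. by move=> [_ _ _ ->]; apply: bigcup_measurable. Qed.

Lemma exhausts_sub D a b n t : exhausts D a b -> a n <= t <= b n -> D t.
Proof. by move=> [_ _ _ ->] h; exists n => //=; rewrite in_itv. Qed.

Lemma exhaust_integrable D a b (f : R -> R) (M : R) : exhausts D a b ->
  measurable_fun D f ->
  (forall n, (\int[mu]_(t in `[a n, b n]) `|f t|%:E <= M%:E)%E) ->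
  mu.-integrable D (EFin \o f).
Proof.
move=> eD mf fM; apply/integrableP; split; first exact/measurable_EFinP.
apply: (@le_lt_trans _ _ M%:E); last exact: ltry.
have mn n : measurable_fun (`[a n, b n]%classic : set mR) (fun t : mR => `|f t|%:E).
  apply/measurable_EFinP; apply: measurableT_comp => //.
  apply: measurable_funS mf; first exact: exhausts_measurable eD.
  by move=> t /=; rewrite in_itv /=; exact: exhausts_sub.
have := @ge0_nondecreasing_set_cvg_integral _ _ R
  (fun n => `[a n, b n]%classic : set mR) (fun t => `|f t|%:E) mu
  (exhausts_nd eD)
  (fun n => measurable_itv _) mn.
have [_ _ _ <-] := eD => /(_ _)/cvg_lim <- //.
apply: lime_le; last exact: nearW.
apply: ereal_nondecreasing_is_cvgn.
apply: ge0_nondecreasing_set_nondecreasing_integral => //.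
exact: exhausts_nd eD.
Qed.

Lemma exhaust_cvg D a b (f : R -> R) : exhausts D a b ->
  mu.-integrable D (EFin \o f) ->
  (fun n => \int[mu]_(t in `[a n, b n]) f t) @ \oo --> \int[mu]_(t in D) f t.
Proof.
move=> eD fi; have mD := exhausts_measurable eD.
have sub n : `[a n, b n] `<=` D.
  by move=> t /=; rewrite in_itv /=; exact: exhausts_sub.
have E n : \int[mu]_(t in `[a n, b n]) f t =
           \int[mu]_(t in D) (f \_ `[a n, b n]) t.
  by rewrite -Rintegral_mkcondr; congr Rintegral; exact/esym/setIidr.
under eq_fun do rewrite E.
have mf : measurable_fun D f by apply/measurable_EFinP/measurable_int; exact: fi.
have [||||] := @real_dominated_convergence R D
  (fun n => f \_ `[a n, b n]) f (fun t => `|f t|%:E) mD => //.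
- move=> n; apply/measurable_restrict; [exact: measurable_itv|exact: mD|].
  by apply: measurable_funS mf => //; exact: subIsetr.
- move=> t Dt; have [_ _ _ DE] := eD; move: Dt; rewrite {1}DE => -[N _ /= tN].
  apply: cvg_near_cst; exists N => // n /= Nn.
  rewrite patchE mem_set//.
  by have /subsetPset := exhausts_nd eD Nn; exact.
- exact: integrable_norm.
- move=> n t Dt; rewrite lee_fin patchE; case: ifP => // _.
  by rewrite normr0.
Qed.

Lemma ftc_segment (f F : R -> R) (a b : R) : a < b ->
  (forall t, a <= t <= b -> is_derive t (1 : R) F (f t)) ->
  (forall t, a <= t <= b -> {for t, continuous f}) ->
  (\int[mu]_(t in `[a, b]) (f t)%:E = (F b - F a)%:E)%E.
Proof.
move=> ab dF cf; rewrite (@continuous_FTC2 _ f F) //.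
- apply: continuous_in_subspaceT => t /set_mem /=; rewrite in_itv /=.
  exact: cf.
- have cF t : a <= t <= b -> F x @[x --> t] --> F t.
    move=> /dF[h _]; apply: differentiable_continuous.
    exact/derivable1_diffP.
  split.
  + move=> t; rewrite in_itv /= => /andP[h1 h2].
    by have [] := dF t; rewrite ?(ltW h1) ?(ltW h2).
  + by apply: cvg_at_right_filter; apply: cF; rewrite lexx ltW.
  + by apply: cvg_at_left_filter; apply: cF; rewrite lexx ltW.
- move=> t; rewrite in_itv /= => /andP[h1 h2].
  have [|_ h] := dF t; first by rewrite (ltW h1) (ltW h2).
  by rewrite derive1E h.
Qed.

Lemma exhaust_ftc D a b (f F : R -> R) (L : R) : exhausts D a b ->
  (forall t, D t -> is_derive t (1 : R) F (f t)) ->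
  (forall t, D t -> {for t, continuous f}) ->
  mu.-integrable D (EFin \o f) ->
  (fun n => F (b n) - F (a n)) @ \oo --> L ->
  \int[mu]_(t in D) f t = L.
Proof.
move=> eD dF cf fi cL; have := exhaust_cvg eD fi.
have [ab _ _ _] := eD.
have sub n t : a n <= t <= b n -> D t by exact: exhausts_sub.
have E n : \int[mu]_(t in `[a n, b n]) f t = F (b n) - F (a n).
  by rewrite /Rintegral (ftc_segment (ab n) (fun t h => dF t (sub n t h))
    (fun t h => cf t (sub n t h))).
rewrite (_ : (fun n => \int[mu]_(t in `[a n, b n]) f t) =
  (fun n => F (b n) - F (a n))); last exact/funext.
by move=> cI; exact: (cvg_unique _ cI cL).
Qed.

(** Over each segment the integral of the nonnegative [f] is an increment of
    [F], and monotone convergence turns the bound [M] into integrability. *)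
Lemma exhaust_ftc_integrable D a b (f F : R -> R) (M : R) : open D ->
  exhausts D a b ->
  (forall t, D t -> is_derive t (1 : R) F (f t)) ->
  (forall t, D t -> {for t, continuous f}) ->
  (forall t, D t -> 0 <= f t) -> (forall n, F (b n) - F (a n) <= M) ->
  mu.-integrable D (EFin \o f).
Proof.
move=> oD eD dF cf f0 FM; have [ab _ _ _] := eD.
have sub n t : a n <= t <= b n -> D t by exact: exhausts_sub.
apply: (@exhaust_integrable D a b f M) => // [|n].
  by apply: open_continuous_measurable_fun => // t /set_mem; exact: cf.
have -> : (\int[mu]_(t in `[a n, b n]) `|f t|%:E =
           \int[mu]_(t in `[a n, b n]) (f t)%:E)%E.
  apply: eq_integral => t /set_mem /=; rewrite in_itv /= => /sub Dt.
  by rewrite ger0_norm ?f0.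
by rewrite (ftc_segment (ab n) (fun t h => dF t (sub n t h))
    (fun t h => cf t (sub n t h))) lee_fin.
Qed.

Lemma exhaust_cftc D a b (f F : R -> R[i]) (L : R[i]) : exhausts D a b ->
  (forall t, D t -> is_cderive F t (f t)) ->
  (forall t, D t -> ccontinuous f t) -> cintegrable D f ->
  ccvg (fun n => F (b n) - F (a n)) L ->
  cintegral D f = L.
Proof.
move=> eD dF cf [ir ii] cL; apply: eqC => /=.
- apply: (@exhaust_ftc D a b _ (fun t => re (F t))) => //.
  + by move=> t /dF[].
  + by move=> t /cf[].
  + by have := ccvg_re cL; under eq_fun do rewrite reB.
- apply: (@exhaust_ftc D a b _ (fun t => im (F t))) => //.
  + by move=> t /dF[].
  + by move=> t /cf[].
  + by have := ccvg_im cL; under eq_fun do rewrite imB.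
Qed.

Lemma substitution_segment (g h h' : R -> R) (O : set R) (a b : R) : open O ->
  `[a, b]%classic `<=` O -> a < b ->
  {in `[a, b] &, {homo h : x y / x < y}} ->
  (forall t, O t -> is_derive t (1 : R) h (h' t)) ->
  (forall t, O t -> {for t, continuous h'}) ->
  (forall u, h a <= u <= h b -> {for u, continuous g}) ->
  (\int[mu]_(u in `[h a, h b]) (g u)%:E =
   \int[mu]_(t in `[a, b]) (g (h t) * h' t)%:E)%E.
Proof.
move=> oO abO ab homo dh ch cg.
have O1 t : a <= t <= b -> O t by move=> tab; apply: abO; rewrite /= in_itv.
have h'E t : O t -> derive1 h t = h' t.
  by move=> /dh[_ e]; rewrite derive1E e.
have ch' t : O t -> {for t, continuous (derive1 h)}.
  move=> Ot; have := ch t Ot; rewrite /prop_for /continuous_at h'E// => c.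
  apply: cvg_trans c; apply: near_eq_cvg.
  have : nbhs t O by exact: open_nbhs_nbhs.
  by apply: filterS => u Ou; rewrite h'E.
have chh t : O t -> h x @[x --> t] --> h t.
  move=> /dh[d _]; apply: differentiable_continuous; exact/derivable1_diffP.
have Oa : O a by apply: O1; rewrite lexx ltW.
have Ob : O b by apply: O1; rewrite lexx ltW.
rewrite (@integration_by_substitution_increasing _ h g a b) ?(ltW ab)//.
- apply: eq_integral => t /set_mem /=; rewrite in_itv /= => /O1 Ot.
  by rewrite fctE h'E.
- move=> t; rewrite in_itv /= => /andP[t1 t2].
  by apply: ch'; apply: O1; rewrite !ltW.
- by apply/cvg_ex; exists (derive1 h a); apply: cvg_at_right_filter; exact: ch'.
- by apply/cvg_ex; exists (derive1 h b); apply: cvg_at_left_filter; exact: ch'.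
- split.
  + move=> t; rewrite in_itv /= => /andP[t1 t2].
    by have [] := dh t (O1 t _); rewrite // !ltW.
  + by apply: cvg_at_right_filter; exact: chh.
  + by apply: cvg_at_left_filter; exact: chh.
- apply: continuous_in_subspaceT => t /set_mem /=; rewrite in_itv /=.
  exact: cg.
Qed.

(** The integrand may be singular at the end points of [E], so the substitution
    is made on the segments of matching exhaustions. The same substitution
    applied to [`|g|] bounds the integrals over the segments of [D], which
    gives the integrability. *)
Lemma exhaust_substitution (D E : set R) a b (g h h' : R -> R) :
  open D -> exhausts D a b -> open E -> exhausts E (h \o a) (h \o b) ->
  {in D &, {homo h : x y / x < y}} ->
  (forall t, D t -> is_derive t (1 : R) h (h' t)) ->
  (forall t, D t -> {for t, continuous h'}) ->
  (forall t, D t -> 0 <= h' t) ->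
  (forall u, E u -> {for u, continuous g}) ->
  mu.-integrable E (EFin \o g) ->
  mu.-integrable D (fun t => (g (h t) * h' t)%:E) /\
  \int[mu]_(t in D) (g (h t) * h' t) = \int[mu]_(u in E) g u.
Proof.
move=> oD eD oE eE homo dh ch h0 cg gi.
have seg n : `[a n, b n]%classic `<=` D.
  by move=> t /=; rewrite in_itv /=; exact: exhausts_sub.
have segE n u : h (a n) <= u <= h (b n) -> E u by exact: (exhausts_sub eE).
have [abD _ _ _] := eD.
have sub (f : R -> R) n : (forall u, E u -> {for u, continuous f}) ->
    (\int[mu]_(u in `[h (a n), h (b n)]) (f u)%:E =
     \int[mu]_(t in `[a n, b n]) (f (h t) * h' t)%:E)%E.
  move=> cf; apply: (@substitution_segment f h h' D) => //.
    by move=> t u ht hu; apply: homo; rewrite inE; exact: (seg n).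
  by move=> u /segE; exact: cf.
have hE t : D t -> E (h t).
  have [_ _ _ DE] := eD; rewrite {1}DE => -[n _ /=]; rewrite in_itv /=.
  move=> /andP[h1 h2]; apply: (segE n); apply/andP.
  have mono u v : D u -> D v -> u <= v -> h u <= h v.
    move=> Du Dv; rewrite le_eqVlt => /predU1P[->//|uv].
    by rewrite ltW// homo ?inE.
  by split; apply: mono => //; apply: (seg n); rewrite /= in_itv /=
    ?lexx ?h1 ?h2 ?(ltW (abD n)).
have chh t : D t -> {for t, continuous h}.
  move=> /dh[d _]; apply: differentiable_continuous; exact/derivable1_diffP.
have mgh : measurable_fun (D : set mR) (fun t : mR => g (h t) * h' t).
  apply: open_continuous_measurable_fun => // t /set_mem Dt.
  apply: cvgM; last exact: ch.
  by apply: continuous_comp; [exact: chh|exact/cg/hE].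
have mE := exhausts_measurable eE.
have ighh : mu.-integrable D (fun t => (g (h t) * h' t)%:E).
  apply: (@exhaust_integrable D a b _ (\int[mu]_(u in E) `|g u|)) => // n.
  have -> : (\int[mu]_(t in `[a n, b n]) `|g (h t) * h' t|%:E =
           \int[mu]_(u in `[h (a n), h (b n)]) `|g u|%:E)%E.
    rewrite (sub (fun u => `|g u|))//; last first.
      by move=> u Eu; apply: cvg_norm; exact: cg.
    apply: eq_integral => t /set_mem /= /seg Dt.
    by rewrite normrM (ger0_norm (h0 _ Dt)).
  rewrite fineK; last first.
    apply: integrable_fin_num => //; exact: integrable_norm.
  apply: ge0_subset_integral => //.
  - apply/measurable_EFinP; apply: measurableT_comp => //.
    by have /measurable_int/measurable_EFinP := gi.
  - by move=> u /=; rewrite in_itv /=; exact: segE.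
split => //.
have cD := exhaust_cvg eD ighh; have cE := exhaust_cvg eE gi.
rewrite (_ : (fun n => \int[mu]_(t in `[a n, b n]) (g (h t) * h' t)) =
  (fun n => \int[mu]_(u in `[(h \o a) n, (h \o b) n]) g u)) in cD; last first.
  by apply/funext => n; rewrite /Rintegral sub.
exact: (cvg_unique _ cD cE).
Qed.

Lemma exhaust_csubstitution (D E : set R) a b (g : R -> R[i]) (h h' : R -> R) :
  open D -> exhausts D a b -> open E -> exhausts E (h \o a) (h \o b) ->
  {in D &, {homo h : x y / x < y}} ->
  (forall t, D t -> is_derive t (1 : R) h (h' t)) ->
  (forall t, D t -> {for t, continuous h'}) ->
  (forall t, D t -> 0 <= h' t) ->
  (forall u, E u -> ccontinuous g u) -> cintegrable E g ->
  cintegrable D (fun t => g (h t) * (h' t)%:C) /\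
  cintegral D (fun t => g (h t) * (h' t)%:C) = cintegral E g.
Proof.
move=> oD eD oE eE homo dh ch h0 cg [gr gi].
have [ir er] := exhaust_substitution oD eD oE eE homo dh ch h0
  (fun u Eu => (cg u Eu).1) gr.
have [ii ei] := exhaust_substitution oD eD oE eE homo dh ch h0
  (fun u Eu => (cg u Eu).2) gi.
have mD := exhausts_measurable eD.
split; first by split; [move: ir|move: ii]; apply: eq_integrable => // t _ /=;
  rewrite ?reMr ?imMr.
by apply: eqC => /=; [rewrite -er|rewrite -ei]; apply: eq_Rintegral => t _;
  rewrite ?reMr ?imMr.
Qed.

Lemma exhausts_itv0x (x : R) : 0 < x ->
  exhausts `]0, x[%classic (fun n => x * n.+3%:R^-1)
                           (fun n => x * (1 - n.+3%:R^-1)).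
Proof.
move=> x0.
have inv3 n : (n.+3%:R^-1 : R) <= 3^-1 by rewrite lef_pV2 ?posrE// ler_nat.
have invm m n : (m <= n)%N -> (n.+3%:R^-1 : R) <= m.+3%:R^-1.
  by move=> mn; rewrite lef_pV2 ?posrE// ler_nat !ltnS.
split.
- by move=> n; rewrite ltr_pM2l//; move: (n.+3%:R^-1 : R) (inv3 n) => y; lra.
- by move=> m n mn; rewrite ler_pM2l// invm.
- by move=> m n mn; rewrite ler_pM2l// lerD2l lerN2 invm.
apply/seteqP; split => t /=; rewrite !in_itv /=.
  move=> /andP[t0 tx].
  set d := Num.min (t / x) (1 - t / x).
  have d0 : 0 < d by rewrite lt_min divr_gt0//= subr_gt0 ltr_pdivrMr// mul1r.
  pose n := (Num.truncn d^-1); exists n => //=; rewrite in_itv /=.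
  have dn : n.+3%:R^-1 <= d.
    rewrite -(invrK d) lef_pV2 ?posrE ?invr_gt0//.
    apply: ltW; apply: lt_le_trans (truncnS_gt _) _.
    by rewrite ler_nat !ltnS -addn2 leq_addr.
  have [d1 d2] : d <= t / x /\ d <= 1 - t / x.
    by split; rewrite ge_min lexx ?orbT.
  have -> : t = x * (t / x) by rewrite mulrC divfK// gt_eqF.
  rewrite !ler_pM2l// (le_trans dn d1)/= lerBrDr.
  by move: (le_trans dn d2); rewrite lerBrDr addrC.
move=> [n _ /=]; rewrite in_itv /= => /andP[t1 t2].
have i0 : 0 < (n.+3%:R^-1 : R) by rewrite invr_gt0.
rewrite (lt_le_trans _ t1) ?mulr_gt0//= (le_lt_trans t2)//.
by rewrite -[ltRHS]mulr1 ltr_pM2l// gtrBl.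
Qed.

Lemma exhausts_itv0y :
  exhausts `]0, +oo[%classic (fun n => n.+2%:R^-1) (fun n => n.+2%:R).
Proof.
have invm m n : (m <= n)%N -> (n.+2%:R^-1 : R) <= m.+2%:R^-1.
  by move=> mn; rewrite lef_pV2 ?posrE// ler_nat !ltnS.
split.
- move=> n; apply: (@lt_le_trans _ _ 1); rewrite ?ler1n//.
  by rewrite invf_lt1// ltr1n.
- by move=> m n mn; rewrite invm.
- by move=> m n mn; rewrite ler_nat !ltnS.
apply/seteqP; split => t /=; rewrite !in_itv /= ?andbT.
  move=> t0; pose n := maxn (Num.truncn t) (Num.truncn t^-1).
  exists n => //=; rewrite in_itv /=; apply/andP; split; last first.
    apply: ltW; apply: lt_le_trans (truncnS_gt _) _.
    by rewrite ler_nat ltnW// !ltnS leq_maxl.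
  rewrite -[leRHS](invrK t) lef_pV2 ?posrE ?invr_gt0//.
  apply: ltW; apply: lt_le_trans (truncnS_gt _) _.
  by rewrite ler_nat ltnW// !ltnS leq_maxr.
move=> [n _ /=]; rewrite in_itv /= => /andP[t1 _].
by rewrite (lt_le_trans _ t1)// invr_gt0.
Qed.

End Exhaustion.


(** * Integrability of the Beta and Gamma densities *)

Section PowerIntegrals.
Context {R : realType}.
Local Notation mu := (@lebesgue_measure R).
Local Notation mR := (measurableTypeR R).
Implicit Types (a b c x t y : R).

Lemma powRE t a : 0 < t -> t `^ a = expR (a * ln t).
Proof. by move=> t0; rewrite /powR gt_eqF. Qed.

Lemma is_derive_powR t a : 0 < t ->
  is_derive t (1 : R) (fun u => u `^ a) (a * t `^ (a - 1)).
Proof.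
move=> t0; split; first by apply: derivable_powR; rewrite in_itv /= t0.
by rewrite -derive1E powR_derive1// in_itv /= t0.
Qed.

Lemma continuous_powR t a : 0 < t -> {for t, continuous (fun u => u `^ a)}.
Proof.
move=> t0; apply: differentiable_continuous; apply/derivable1_diffP.
by have [] := is_derive_powR a t0.
Qed.

Lemma continuous_subl x t : {for t, continuous (fun u : R => x - u)}.
Proof. by apply: cvgB; [exact: cvg_cst|exact: cvg_id]. Qed.

Lemma continuous_powR_subl x b t : t < x ->
  {for t, continuous (fun u : R => (x - u) `^ b)}.
Proof.
move=> tx; apply: (@continuous_comp _ _ _ (fun u : R => x - u)
  (fun u : R => u `^ b)); first exact: continuous_subl.
by apply: continuous_powR; rewrite subr_gt0.
Qed.

Lemma powR_mono y z a : 0 <= a -> 0 <= y -> y <= z -> y `^ a <= z `^ a.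
Proof. by move=> a0 y0 yz; apply: ge0_ler_powR; rewrite // nnegrE// (le_trans y0). Qed.

(** The sign of [a] decides which end of the segment gives the maximum; the sum
    of the two end values serves both cases. *)
Lemma powR_le_ends y a x : 0 < x -> x / 2 <= y <= x ->
  y `^ a <= x `^ a + (x / 2) `^ a.
Proof.
move=> x0 /andP[xy yx]; have x20 : 0 < x / 2 by rewrite divr_gt0.
have y0 : 0 < y by apply: lt_le_trans xy.
have [a0|a0] := leP 0 a.
  apply: (le_trans (powR_mono a0 (ltW y0) yx)).
  by rewrite lerDl powR_ge0.
apply: (@le_trans _ _ ((x / 2) `^ a)); last by rewrite lerDr powR_ge0.
rewrite -(opprK a) !(powRN _ (- a)) lef_pV2 ?posrE ?powR_gt0//.
by apply: powR_mono; rewrite // ?oppr_ge0 ltW.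
Qed.

Lemma integrable_powR_itv0x x a : 0 < x -> 0 < a ->
  mu.-integrable `]0, x[%classic (fun t => (t `^ (a - 1))%:E).
Proof.
move=> x0 a0.
have i0 (t : R) : `]0, x[%classic t -> 0 < t by rewrite /= in_itv /= => /andP[].
apply: (@exhaust_ftc_integrable R `]0, x[%classic _ _ (fun t => t `^ (a - 1))
  (fun t => a^-1 * t `^ a) (a^-1 * x `^ a) _ (exhausts_itv0x x0)).
- exact: interval_open.
- move=> t /i0 t0; apply: (is_derive_eq (is_deriveZ a^-1 (is_derive_powR a t0))).
  by rewrite /GRing.scale /= mulrA mulVf ?mul1r// gt_eqF.
- by move=> t /i0; exact: continuous_powR.
- by move=> t _; exact: powR_ge0.
- move=> n; apply: (@le_trans _ _ (a^-1 * (x * (1 - n.+3%:R^-1)) `^ a)).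
    by rewrite lerBlDr lerDl mulr_ge0 ?powR_ge0// invr_ge0 ltW.
  have n1 : n.+3%:R^-1 <= (1 : R) by rewrite invf_le1// ler1n.
  rewrite ler_pM2l ?invr_gt0//; apply: powR_mono; rewrite ?(ltW a0)//.
    by rewrite mulr_ge0// ?subr_ge0// ltW.
  by rewrite -[leRHS]mulr1 ler_pM2l// gerBl.
Qed.

Lemma integrable_powR_subl x b : 0 < x -> 0 < b ->
  mu.-integrable `]0, x[%classic (fun t => ((x - t) `^ (b - 1))%:E).
Proof.
move=> x0 b0.
have i0 (t : R) : `]0, x[%classic t -> 0 < x - t.
  by rewrite /= in_itv /= subr_gt0 => /andP[].
apply: (@exhaust_ftc_integrable R `]0, x[%classic _ _ (fun t => (x - t) `^ (b - 1))
  (fun t => - b^-1 * (x - t) `^ b) (b^-1 * x `^ b) _ (exhausts_itv0x x0)).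
- exact: interval_open.
- move=> t /i0 t0.
  have ds : is_derive t (1 : R) (fun u => x - u) (-1).
    by apply: (is_derive_eq (is_deriveB (is_derive_cst x t 1) (is_derive_id t 1)));
      rewrite sub0r.
  have dc := @is_derive1_comp R (fun u => u `^ b) (fun u => x - u) t _ _
    (is_derive_powR b t0) ds.
  apply: (is_derive_eq (is_deriveZ (- b^-1) dc)).
  by rewrite /GRing.scale /= mulrN1 mulrNN mulrA mulVf ?mul1r// gt_eqF.
- by move=> t /i0; rewrite subr_gt0; exact: continuous_powR_subl.
- by move=> t _; exact: powR_ge0.
- move=> n; rewrite !mulNr opprK addrC.
  apply: (@le_trans _ _ (b^-1 * (x - x * n.+3%:R^-1) `^ b)).
    by rewrite gerBl mulr_ge0 ?powR_ge0// invr_ge0 ltW.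
  have n1 : n.+3%:R^-1 <= (1 : R) by rewrite invf_le1// ler1n.
  have n0 : 0 <= n.+3%:R^-1 :> R by rewrite invr_ge0.
  rewrite ler_pM2l ?invr_gt0//; apply: powR_mono; rewrite ?(ltW b0)//.
    by rewrite subr_ge0 -[leRHS]mulr1 ler_pM2l.
  by rewrite gerBl mulr_ge0// ltW.
Qed.

Lemma continuous_beta_integrand x a b t : 0 < t < x ->
  {for t, continuous (fun t => t `^ a * (x - t) `^ b)}.
Proof.
move=> /andP[t0 tx]; apply: cvgM; first exact: continuous_powR.
exact: continuous_powR_subl.
Qed.

(** Each factor is bounded on the half of the interval where the other one is
    singular, so that the product is below a combination of the two factors. *)
Lemma integrable_beta x a b : 0 < x -> 0 < a -> 0 < b ->
  mu.-integrable `]0, x[%classic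
    (fun t => (t `^ (a - 1) * (x - t) `^ (b - 1))%:E).
Proof.
move=> x0 a0 b0.
pose C c := x `^ (c - 1) + (x / 2) `^ (c - 1).
have C0 c : 0 <= C c by rewrite addr_ge0 ?powR_ge0.
have mD : measurable (`]0, x[%classic : set mR) by exact: measurable_itv.
have := integrableD mD (integrableZl mD (C b) (integrable_powR_itv0x x0 a0))
                       (integrableZl mD (C a) (integrable_powR_subl x0 b0)).
apply: (le_integrable mD).
  apply/measurable_EFinP; apply: open_continuous_measurable_fun => //.
  by move=> t /set_mem /=; rewrite in_itv /=; exact: continuous_beta_integrand.
move=> t /=; rewrite in_itv /= => /andP[t0 tx].
rewrite lee_fin !ger0_norm ?addr_ge0 ?mulr_ge0 ?powR_ge0//.
have [tx2|tx2] := leP t (x / 2).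
  apply: (@le_trans _ _ (C b * t `^ (a - 1))).
    rewrite mulrC ler_pM2r ?powR_gt0//; apply: powR_le_ends => //.
    by apply/andP; split; lra.
  by rewrite lerDl mulr_ge0 ?powR_ge0.
apply: (@le_trans _ _ (C a * (x - t) `^ (b - 1))).
  rewrite ler_pM2r ?powR_gt0 ?subr_gt0//; apply: powR_le_ends => //.
  by rewrite !ltW.
by rewrite lerDr mulr_ge0 ?powR_ge0.
Qed.

Lemma expR_ge_pow y n : 0 <= y -> y ^+ n <= n`!%:R * expR y.
Proof.
case: n => [|n] y0; first by rewrite expr0 fact0 mul1r -expR0 ler_expR.
rewrite mulrC -ler_pdivrMr ?ltr0n ?fact_gt0//.
by apply: le_trans (expR_ge1Dxn n y0); rewrite lerDr.
Qed.

(** An exponential beats every power: [1 + t^a] is at most [2 (1 + t)^N] for an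
    integer [N >= a], and [(c (1 + t))^(2N) / (2N)!] is at most
    [exp (c (1 + t))]. *)
Lemma powR_expR_bounded a c : 0 < a -> 0 < c ->
  exists2 C, 0 < C & forall t, 0 < t -> (1 + t `^ a) ^+ 2 * expR (- (c * t)) <= C.
Proof.
move=> a0 c0; pose N := (Num.truncn a).+1.
pose C := 4 * (N.*2)`!%:R / c ^+ N.*2 * expR c.
exists C.
  by rewrite !mulr_gt0 ?expR_gt0 ?invr_gt0 ?exprn_gt0 ?ltr0n ?fact_gt0.
move=> t t0.
have u1 : 1 <= 1 + t by rewrite lerDl ltW.
have h1 : 1 + t `^ a <= 2 * (1 + t) ^+ N.
  have -> : 2 * (1 + t) ^+ N = (1 + t) ^+ N + (1 + t) ^+ N by ring.
  apply: lerD; first exact: exprn_ege1.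
  apply: (@le_trans _ _ ((1 + t) `^ a)).
    by apply: powR_mono; rewrite ?ltW// ltrDr.
  rewrite -powR_mulrn ?(le_trans _ u1)//; apply: ler_powR => //.
  exact/ltW/truncnS_gt.
have h2 : (1 + t `^ a) ^+ 2 <= 4 * (1 + t) ^+ N.*2.
  apply: (@le_trans _ _ ((2 * (1 + t) ^+ N) ^+ 2)).
    by rewrite ler_sqr ?nnegrE ?addr_ge0 ?powR_ge0// (le_trans _ h1)// addr_ge0 ?powR_ge0.
  by rewrite exprMn -exprM muln2 -natrX.
have h3 : (1 + t) ^+ N.*2 <= (N.*2)`!%:R / c ^+ N.*2 * expR (c * (1 + t)).
  have := @expR_ge_pow (c * (1 + t)) N.*2.
  rewrite exprMn mulr_ge0 ?(ltW c0) ?(le_trans _ u1)// => /(_ isT) h.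
  by rewrite mulrAC ler_pdivlMr ?exprn_gt0// mulrC.
have e0 := expR_gt0 (- (c * t)).
apply: (@le_trans _ _ (4 * ((N.*2)`!%:R / c ^+ N.*2 * expR (c * (1 + t))) * expR (- (c * t)))).
  by rewrite ler_pM2r// (le_trans h2)// ler_pM2l.
rewrite /C -!mulrA -expRD; apply: ler_wpM2l => //; apply: ler_wpM2l => //.
apply: ler_wpM2l; first by rewrite invr_ge0 exprn_ge0 // ltW.
by rewrite ler_expR; lra.
Qed.

(** Comparison with [t^(a-1) / (1 + t^a)^2], whose primitive
    [- 1 / (a (1 + t^a))] is bounded on the half-line. *)
Lemma integrable_gamma a c : 0 < a -> 0 < c ->
  mu.-integrable `]0, +oo[%classic (fun t => (t `^ (a - 1) * expR (- (c * t)))%:E).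
Proof.
move=> a0 c0.
have i0 (t : R) : `]0, +oo[%classic t -> 0 < t by rewrite /= in_itv /= andbT.
have p1 (t : R) : 0 < 1 + t `^ a by rewrite ltr_pwDl ?powR_ge0.
have mD : measurable (`]0, +oo[%classic : set mR) by exact: measurable_itv.
have ig : mu.-integrable `]0, +oo[%classic
    (EFin \o (fun t => t `^ (a - 1) / (1 + t `^ a) ^+ 2)).
  apply: (@exhaust_ftc_integrable R `]0, +oo[%classic _ _
    (fun t => t `^ (a - 1) / (1 + t `^ a) ^+ 2)
    (fun t => - a^-1 * (1 + t `^ a)^-1) a^-1 _ exhausts_itv0y).
  - exact: interval_open.
  - move=> t /i0 t0.
    have d1 : is_derive t (1 : R) (fun u => 1 + u `^ a) (a * t `^ (a - 1)).
      by apply: (is_derive_eq (is_deriveD (is_derive_cst (1 : R) t (1 : R)) (is_derive_powR a t0)));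
        rewrite add0r.
    have nz : 1 + t `^ a != 0 by rewrite gt_eqF.
    have dV := @is_deriveV _ (fun u : R => 1 + u `^ a) t _ 1 nz d1.
    apply: (is_derive_eq (is_deriveZ (- a^-1) dV)).
    rewrite /GRing.scale /=; field; rewrite nz gt_eqF//=.
  - move=> t /i0 t0; apply: cvgM; first exact: continuous_powR.
    apply: cvgV; first by rewrite expf_neq0// gt_eqF.
    apply: cvgM; apply: cvgD; (try exact: cvg_cst); exact: continuous_powR.
  - by move=> t _; rewrite mulr_ge0 ?powR_ge0// invr_ge0 exprn_ge0// ltW.
  - move=> n; rewrite !mulNr opprK addrC.
    apply: (@le_trans _ _ (a^-1 * (1 + n.+2%:R^-1 `^ a)^-1)).
      by rewrite gerBl mulr_ge0// invr_ge0 ltW.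
    rewrite -[leRHS]mulr1 ler_pM2l ?invr_gt0//.
    by rewrite invf_le1// lerDl powR_ge0.
have [C C0 HC] := powR_expR_bounded a0 c0.
have := integrableZl mD C ig.
apply: (le_integrable mD).
  apply/measurable_EFinP; apply: open_continuous_measurable_fun => //.
  move=> t /set_mem /i0 t0; apply: cvgM; first exact: continuous_powR.
  apply: continuous_comp; last exact: continuous_expR.
  by apply: cvgN; apply: cvgM; [exact: cvg_cst|exact: cvg_id].
move=> t /i0 t0; rewrite lee_fin !ger0_norm ?mulr_ge0 ?powR_ge0 ?expR_ge0
  ?invr_ge0 ?exprn_ge0 ?(ltW C0) ?(ltW (p1 t))//.
rewrite mulrCA ler_pM2l ?powR_gt0// ler_pdivlMr ?exprn_gt0//.
by rewrite mulrC; exact: HC.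
Qed.

End PowerIntegrals.

(** * The Beta integral *)

Section BetaIntegral.
Context {R : realType}.
Local Notation mu := (@lebesgue_measure R).
Local Notation mR := (measurableTypeR R).
Implicit Types (p q s z : R[i]) (x t : R).

Lemma itv0xP x t : `]0, x[%classic t -> 0 < t < x.
Proof. by rewrite /= in_itv. Qed.

Lemma cvg_powR0 (u : nat -> R) (a : R) : 0 < a -> (forall n, 0 < u n) ->
  u @ \oo --> (0 : R) -> (fun n => u n `^ a) @ \oo --> (0 : R).
Proof.
move=> a0 u0 cu; have /cvg_at_rightP := @powR_cvg0 R a a0.
by apply; split.
Qed.

Lemma cvg_scaled_inv x : (fun n => x * n.+3%:R^-1 : R) @ \oo --> (0 : R).
Proof.
rewrite -(mulr0 x); apply: cvgM; first exact: cvg_cst.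
have := @cvg_harmonic R; rewrite -(cvg_shiftn 2); apply: cvg_trans.
by apply: near_eq_cvg; apply: nearW => n /=; rewrite /harmonic /= addn2.
Qed.

Lemma ccontinuous_cpow s t : 0 < t -> ccontinuous (fun u => cpow u s) t.
Proof. by move=> t0; apply: is_cderive_continuous (is_cderive_cpow s t0). Qed.

Lemma is_cderive_cpow_subl x s t : t < x ->
  is_cderive (fun u => cpow (x - u) s) t (- (s * cpow (x - t) (s - 1))).
Proof.
move=> tx.
have ds : is_derive t (1 : R) (fun u => x - u) (-1).
  by apply: (is_derive_eq (is_deriveB (is_derive_cst x t 1) (is_derive_id t 1)));
    rewrite sub0r.
have xt0 : 0 < x - t by rewrite subr_gt0.
apply: (is_cderive_eq (@is_cderive_comp R (fun u => cpow u s) (fun u => x - u) t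
  _ _ (is_cderive_cpow s xt0) ds)).
by rewrite rmorphN rmorph1 mulrN1.
Qed.

Lemma ccontinuous_cpow_subl x s t : t < x ->
  ccontinuous (fun u => cpow (x - u) s) t.
Proof.
by move=> tx; apply: is_cderive_continuous (is_cderive_cpow_subl s tx).
Qed.

Definition beta_integrand x p q t := cpow t (p - 1) * cpow (x - t) (q - 1).

Definition beta_integral x p q := cintegral `]0, x[ (beta_integrand x p q).

Lemma ccontinuous_beta_integrand x p q t : 0 < t < x ->
  ccontinuous (beta_integrand x p q) t.
Proof.
move=> /andP[t0 tx]; apply: ccontinuousM; first exact: ccontinuous_cpow.
exact: ccontinuous_cpow_subl.
Qed.

Lemma normc_beta_integrand x p q t : 0 < t < x ->
  normc (beta_integrand x p q t) = t `^ (re p - 1) * (x - t) `^ (re q - 1).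
Proof.
move=> /andP[t0 tx]; rewrite normcM !normc_cpow ?subr_gt0//.
by rewrite !reB re1.
Qed.

Lemma cintegrable_beta x p q : 0 < x -> 0 < re p -> 0 < re q ->
  cintegrable `]0, x[ (beta_integrand x p q).
Proof.
move=> x0 p0 q0; apply: (cintegrable_le _ _ (integrable_beta x0 p0 q0)).
- exact: measurable_itv.
- apply: open_ccontinuous_cmeasurable; first exact: interval_open.
  by move=> t /=; rewrite in_itv /=; exact: ccontinuous_beta_integrand.
- by move=> t /itv0xP h; rewrite normc_beta_integrand.
Qed.

Lemma integral_normc_beta x p q : 0 < x ->
  \int[mu]_(t in `]0, x[) normc (beta_integrand x p q t) =
  re (beta_integral x (re p)%:C (re q)%:C).
Proof.
move=> x0; apply: eq_Rintegral => t /set_mem/itv0xP h.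
have /andP[t0 tx] := h.
rewrite normc_beta_integrand// /beta_integrand -!(rmorphB _ _ 1) !cpow_real ?subr_gt0//.
by rewrite -rmorphM.
Qed.

(** The derivative of [t^p (x - t)^q] has integral 0, since this function
    vanishes at both ends. *)
Lemma beta_integral_by_parts x p q : 0 < x -> 0 < re p -> 0 < re q ->
  p * beta_integral x p (q + 1) = q * beta_integral x (p + 1) q.
Proof.
move=> x0 p0 q0.
have mD : measurable (`]0, x[%classic : set mR) by exact: measurable_itv.
have q1 : 0 < re (q + 1) by rewrite reD re1 addr_gt0.
have p1 : 0 < re (p + 1) by rewrite reD re1 addr_gt0.
have i1 := cintegrable_beta x0 p0 q1.
have i2 := cintegrable_beta x0 p1 q0.
apply/subr0_eq; rewrite -[RHS](_ : cintegral `]0, x[ (fun t =>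
  p * beta_integrand x p (q + 1) t + (- q) * beta_integrand x (p + 1) q t) = 0);
  last first.
  apply: (@exhaust_cftc R `]0, x[%classic _ _ _
    (fun t => cpow t p * cpow (x - t) q) 0 (exhausts_itv0x x0)).
  - move=> t /itv0xP /andP[t0 tx].
    apply: (is_cderive_eq (is_cderiveM (is_cderive_cpow p t0)
      (is_cderive_cpow_subl q tx))).
    by rewrite /beta_integrand !addrK; ring.
  - move=> t /itv0xP h; apply: ccontinuousD; apply: ccontinuousZ;
      exact: ccontinuous_beta_integrand.
  - by apply: cintegrableD => //; exact: cintegrableZ.
  - pose u n : R := x * n.+3%:R^-1.
    have u0 n : 0 < u n by rewrite mulr_gt0// invr_gt0.
    have ux n : u n < x by rewrite gtr_pMr// invf_lt1// ltr1n.
    have xu n : x * (1 - n.+3%:R^-1) = x - u n by rewrite mulrBr mulr1.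
    apply: (@ccvg_squeeze _ _ _ (fun n => x `^ re p * u n `^ re q +
                                          u n `^ re p * x `^ re q)).
      apply: nearW => n; rewrite subr0 xu -/(u n).
      have un0 : 0 < x - u n by rewrite subr_gt0.
      apply: le_trans (normcB _ _) _; rewrite !normcM subKr !normc_cpow//.
      by apply: lerD; [apply: ler_wpM2r|apply: ler_wpM2l];
        rewrite ?powR_ge0//; apply: powR_mono; rewrite ?ltW// gtrBl.
    have cu : u @ \oo --> (0 : R) by exact: cvg_scaled_inv.
    rewrite -[X in _ --> X](_ : x `^ re p * 0 + 0 * x `^ re q = 0); last first.
      by rewrite mulr0 mul0r addr0.
    apply: cvgD; apply: cvgM; (try exact: cvg_cst); exact: cvg_powR0.
rewrite cintegralD ?cintegralZ ?mulNr//; exact: cintegrableZ.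
Qed.

(** From [x = t + (x - t)]. *)
Lemma beta_integral_split x p q : 0 < x -> 0 < re p -> 0 < re q ->
  beta_integral x (p + 1) q + beta_integral x p (q + 1) =
  x%:C * beta_integral x p q.
Proof.
move=> x0 p0 q0.
have mD : measurable (`]0, x[%classic : set mR) by exact: measurable_itv.
have q1 : 0 < re (q + 1) by rewrite reD re1 addr_gt0.
have p1 : 0 < re (p + 1) by rewrite reD re1 addr_gt0.
rewrite -cintegralD//; try exact: cintegrable_beta.
rewrite -cintegralZ//; last exact: cintegrable_beta.
apply: eq_cintegral => t /set_mem/itv0xP/andP[t0 tx].
rewrite /beta_integrand [p + 1 - 1]addrAC [q + 1 - 1]addrAC.
rewrite (cpowD t _ 1) (cpowD (x - t) _ 1) !cpowr1 ?subr_gt0//.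
have -> : x%:C = t%:C + (x - t)%:C :> R[i] by rewrite -rmorphD addrC subrK.
by ring.
Qed.

Lemma beta_integralS x p q : 0 < x -> 0 < re p -> 0 < re q ->
  (p + q) * beta_integral x p (q + 1) = q * x%:C * beta_integral x p q.
Proof.
move=> x0 p0 q0; rewrite -mulrA -beta_integral_split// mulrDl mulrDr.
by rewrite beta_integral_by_parts.
Qed.

Lemma pochhammer0 p : pochhammer p 0 = 1.
Proof. by rewrite /pochhammer big_ord0. Qed.

Lemma pochhammerSr p n : pochhammer p n.+1 = pochhammer p n * (p + n%:R).
Proof. by rewrite /pochhammer big_ord_recr. Qed.

Lemma pochhammerSl p n : pochhammer p n.+1 = p * pochhammer (p + 1) n.
Proof.
rewrite /pochhammer big_ord_recl /= addr0; congr (_ * _).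
by apply: eq_bigr => i _; rewrite /bump /= natrD addrA.
Qed.

Lemma pochhammer1 n : pochhammer (1 : R[i]) n = n`!%:R.
Proof.
elim: n => [|n IH]; first by rewrite pochhammer0.
by rewrite pochhammerSr IH factS mulnC natrM -[n.+1]add1n natrD.
Qed.

Lemma re_gt0_neq0 p : 0 < re p -> p != 0.
Proof. by move=> p0; apply: contraTneq p0 => ->; rewrite ltxx. Qed.

Lemma addn_re_gt0 p n : 0 < re p -> 0 < re (p + n%:R).
Proof. by move=> p0; rewrite reD re_nat ltr_wpDr. Qed.

Lemma pochhammer_neq0 p n : 0 < re p -> pochhammer p n != 0.
Proof.
move=> p0; apply/prodf_neq0 => i _; exact/re_gt0_neq0/addn_re_gt0.
Qed.

Lemma beta_integralDn x p q n : 0 < x -> 0 < re p -> 0 < re q ->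
  pochhammer (p + q) n * beta_integral x p (q + n%:R) =
  pochhammer q n * x%:C ^+ n * beta_integral x p q.
Proof.
move=> x0 p0 q0; elim: n => [|n IH]; first by rewrite !pochhammer0 expr0 addr0 !mul1r.
rewrite !pochhammerSr -addn1 natrD [q + _]addrA -[p + q + _]addrA -mulrA.
rewrite beta_integralS//; last exact: addn_re_gt0.
rewrite mulrCA IH addn1 exprSr; ring.
Qed.

Lemma beta_integral_scale x p q : 0 < x -> 0 < re p -> 0 < re q ->
  beta_integral x p q = cpow x (p + q - 1) * beta_integral 1 p q.
Proof.
move=> x0 p0 q0.
have m1 : measurable (`]0, 1[%classic : set mR) by exact: measurable_itv.
have eE : exhausts `]0, x[%classic
    ((fun u : R => x * u) \o (fun n => 1 * n.+3%:R^-1))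
    ((fun u : R => x * u) \o (fun n => 1 * (1 - n.+3%:R^-1))).
  rewrite (_ : _ \o _ = (fun n => x * n.+3%:R^-1)); last first.
    by apply/funext => n /=; rewrite mul1r.
  rewrite (_ : _ \o _ = (fun n => x * (1 - n.+3%:R^-1))); last first.
    by apply/funext => n /=; rewrite mul1r.
  exact: exhausts_itv0x.
have o1 : open (`]0, 1[%classic : set R) by exact: interval_open.
have ox : open (`]0, x[%classic : set R) by exact: interval_open.
have [||||||_ e] := exhaust_csubstitution (g := beta_integrand x p q)
  (h' := fun=> x) o1 (exhausts_itv0x ltr01) ox eE.
- by move=> t u _ _ tu; rewrite ltr_pM2l.
- move=> t _; apply: (is_derive_eq (is_deriveZ x (is_derive_id t 1))).
  by rewrite /GRing.scale /= mulr1.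
- by move=> t _; exact: cvg_cst.
- by move=> t _; exact: ltW.
- by move=> u /itv0xP; exact: ccontinuous_beta_integrand.
- exact: cintegrable_beta.
rewrite [LHS]/beta_integral -e -cintegralZ//; last exact: cintegrable_beta.
apply: eq_cintegral => t /set_mem/itv0xP/andP[t0 t1].
rewrite /beta_integrand (_ : x - x * t = x * (1 - t)); last by ring.
rewrite !cpowM ?subr_gt0//.
have -> : p + q - 1 = (p - 1) + (q - 1) + 1 :> R[i] by ring.
rewrite (cpowD x _ 1) (cpowD x (p - 1)) cpowr1//; ring.
Qed.

Lemma beta_integral_r1 p : 0 < re p -> beta_integral 1 p 1 = p^-1.
Proof.
move=> p0; have p_neq0 := re_gt0_neq0 p0.
have E t : 0 < t < 1 -> beta_integrand 1 p 1 t = cpow t (p - 1).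
  by move=> _; rewrite /beta_integrand subrr cpow0 mulr1.
apply: (@exhaust_cftc R `]0, 1[%classic _ _ _
    (fun t => p^-1 * cpow t p) p^-1 (exhausts_itv0x ltr01)).
- move=> t /itv0xP h; have /andP[t0 t1] := h; rewrite E//.
  have dc : is_cderive (fun=> p^-1) t 0 by split; exact: is_derive_cst.
  apply: (is_cderive_eq (is_cderiveM dc (is_cderive_cpow p t0))).
  by rewrite mul0r add0r mulrA mulVf ?mul1r.
- by move=> t /itv0xP; exact: ccontinuous_beta_integrand.
- by apply: cintegrable_beta => //; rewrite re1.
- have cu := cvg_scaled_inv (1 : R).
  have u0 n : 0 < 1 * n.+3%:R^-1 :> R by rewrite mul1r invr_gt0.
  have c0 : ccvg (fun n => cpow (1 * n.+3%:R^-1 : R) p) 0.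
    apply: ccvg_squeeze (cvg_powR0 p0 u0 cu); apply: nearW => n.
    by rewrite subr0 normc_cpow.
  have cu1 : (fun n => 1 * (1 - n.+3%:R^-1) : R) @ \oo --> (1 : R).
    rewrite -[X in _ --> X](_ : 1 - 0 = 1 :> R); last by rewrite subr0.
    under eq_fun do rewrite mulrBr mulr1.
    by apply: cvgB; [exact: cvg_cst|exact: cu].
  have c1 : ccvg (fun n => cpow (1 * (1 - n.+3%:R^-1) : R) p) 1.
    have [cr ci] := ccontinuous_cpow p (@ltr01 R).
    rewrite -(cpow1r p); apply: ccvg_reim.
    + exact: (cvg_comp _ _ cu1 cr).
    + exact: (cvg_comp _ _ cu1 ci).
  rewrite -[X in ccvg _ X](_ : p^-1 * 1 - p^-1 * 0 = p^-1); last first.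
    by rewrite mulr1 mulr0 subr0.
  by apply: ccvgB; apply: ccvgZ.
Qed.

End BetaIntegral.

(** * Euler's limit for the Gamma function *)

Section EulerLimit.
Context {R : realType}.
Local Notation mu := (@lebesgue_measure R).
Local Notation mR := (measurableTypeR R).
Implicit Types (p q s z : R[i]) (t : R).

Lemma cintegral_restrict (D E : set mR) (f : R -> R[i]) :
  E `<=` D ->
  cintegral E f = cintegral D (fun t => if t \in E then f t else 0).
Proof.
move=> ED; apply: eqC => /=.
  rewrite -{1}(setIidr ED) Rintegral_mkcondr; apply: eq_Rintegral => t _.
  by rewrite patchE; case: ifP.
rewrite -{1}(setIidr ED) Rintegral_mkcondr; apply: eq_Rintegral => t _.
by rewrite patchE; case: ifP.
Qed.

Lemma cmeasurable_restrict (D E : set mR) (f : R -> R[i]) :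
  measurable D -> measurable E -> E `<=` D -> cmeasurable E f ->
  cmeasurable D (fun t => if t \in E then f t else 0).
Proof.
move=> mD mE ED [mr mi]; split.
  rewrite (_ : (fun t => _) = (fun t => re (f t)) \_ E); last first.
    by apply/funext => t; rewrite patchE; case: ifP.
  by apply/measurable_restrict => //; apply: measurable_funS mr => //;
    exact: subIsetl.
rewrite (_ : (fun t => _) = (fun t => im (f t)) \_ E); last first.
  by apply/funext => t; rewrite patchE; case: ifP.
by apply/measurable_restrict => //; apply: measurable_funS mi => //;
  exact: subIsetl.
Qed.

Lemma near_lt_nat t : \forall n \near \oo, t < n.+2%:R.
Proof.
exists (Num.truncn t) => // n /= h; apply: lt_le_trans (truncnS_gt _) _.
by rewrite ler_nat ltnS leqW.
Qed.

Lemma cvg_invn2 : (fun n => n.+2%:R^-1 : R) @ \oo --> (0 : R).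
Proof.
have := @cvg_harmonic R; rewrite -(cvg_shiftn 1); apply: cvg_trans.
by apply: near_eq_cvg; apply: nearW => n /=; rewrite /harmonic /= addn1.
Qed.

(** Both bounds are [ln (1 + u) <= u], for [u = - y] and for [u = y / (1 - y)],
    as [1 / (1 - y) = 1 + y / (1 - y)]. *)
Lemma ln_oneB_bounds y : 0 < y < 1 -> - (y / (1 - y)) <= ln (1 - y) <= (- y : R).
Proof.
move=> /andP[y0 y1]; have y1' : 0 < 1 - y by rewrite subr_gt0.
rewrite (@le_ln1Dx _ (- y)) ?ltrN2// andbT lerNl -lnV ?posrE//.
rewrite [X in ln X](_ : _ = 1 + y / (1 - y)); last by field; rewrite gt_eqF.
by apply: le_ln1Dx; apply: lt_trans (divr_gt0 y0 y1'); rewrite oppr_lt0.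
Qed.

Lemma cvg_mul_ln t : 0 < t ->
  (fun n => n.+2%:R * ln (1 - t / n.+2%:R)) @ \oo --> - t.
Proof.
move=> t0.
have ct : (fun n => t / n.+2%:R : R) @ \oo --> (0 : R).
  by rewrite -(mulr0 t); apply: cvgM; [exact: cvg_cst|exact: cvg_invn2].
have c1 : (fun n => - (t / (1 - t / n.+2%:R)) : R) @ \oo --> - t.
  rewrite -[X in _ --> X](_ : - (t / (1 - 0)) = - t); last by rewrite subr0 divr1.
  apply: cvgN; apply: cvgM; first exact: cvg_cst.
  by apply: cvgV; [rewrite subr0 oner_eq0|apply: cvgB => //; exact: cvg_cst].
apply: (squeeze_cvgr _ c1 (cvg_cst (- t))).
apply: filterS (near_lt_nat t) => n tn.
have n0 : 0 < n.+2%:R :> R by [].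
have y01 : 0 < t / n.+2%:R < 1 by rewrite divr_gt0//= ltr_pdivrMr// mul1r.
have /andP[h1 h2] := ln_oneB_bounds y01.
apply/andP; split.
  apply: (le_trans _ (ler_wpM2l (ltW n0) h1)).
  rewrite le_eqVlt; apply/orP; left; apply/eqP.
  have nz : n.+2%:R - t != 0 by rewrite subr_eq0 gt_eqF.
  by move: (n.+2%:R : R) n0 nz => N N0 nz; field; rewrite nz gt_eqF.
apply: (le_trans (ler_wpM2l (ltW n0) h2)).
by rewrite mulrN mulrC divfK// gt_eqF.
Qed.

Lemma ccvg_cpow_exp q t : 0 < t ->
  ccvg (fun n => cpow (1 - t / n.+2%:R) (q + n.+2%:R - 1)) (expR (- t))%:C.
Proof.
move=> t0; have cl := cvg_mul_ln t0.
have c0 : (fun n => ln (1 - t / n.+2%:R)) @ \oo --> (0 : R).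
  rewrite -(mulr0 (- t)) (_ : (fun n => _) =
    (fun n => n.+2%:R * ln (1 - t / n.+2%:R) * n.+2%:R^-1)).
    by apply: cvgM; [exact: cl|exact: cvg_invn2].
  by apply/funext => n; rewrite mulrAC mulfV ?mul1r// pnatr_eq0.
rewrite -cexpC /cpow.
rewrite (_ : (fun n => _) = (fun n => cexp ((q - 1) * (ln (1 - t / n.+2%:R))%:C +
    (n.+2%:R * ln (1 - t / n.+2%:R))%:C))); last first.
  by apply/funext => n; congr cexp; rewrite rmorphM rmorph_nat; ring.
apply: ccvg_cexp; rewrite -[X in ccvg _ X](_ : (q - 1) * 0%:C + (- t)%:C = _).
  by apply: ccvgD; [apply: ccvgZ|]; exact: ccvg_real.
by rewrite mulr0 add0r.
Qed.

(** After scaling to [`]0, n[], the integrand [t^(p-1) (1 - t/n)^(q+n-1)] tends to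
    [t^(p-1) exp (-t)] and is dominated by [t^(Re p - 1) exp (-t/2)]. The limit
    does not depend on [q]: [q = 1] will give Euler's limit for Gamma, and a
    general [q] the value of the Beta integral. *)
Lemma euler_limit_integral p q : 0 < re p -> 0 < re q ->
  ccvg (fun n => cpow n.+2%:R p * beta_integral 1 p (q + n.+2%:R))
       (euler_integral p).
Proof.
move=> p0 q0.
pose D : set mR := `]0, +oo[%classic.
pose E n : set mR := `]0, n.+2%:R[%classic.
pose h n t := cpow t (p - 1) * cpow (1 - t / n.+2%:R) (q + n.+2%:R - 1).
pose f_ n t := if t \in E n then h n t else 0.
have mD : measurable D by exact: measurable_itv.
have mE n : measurable (E n) by exact: measurable_itv.
have ED n : E n `<=` D by move=> t /itv0xP/andP[t0 _]; rewrite /D /= in_itv /= t0.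
have n0 n : 0 < n.+2%:R :> R by [].
have hE n t : E n t -> h n t =
    cpow n.+2%:R (- (q + n.+2%:R - 1)) * beta_integrand n.+2%:R p (q + n.+2%:R) t.
  move=> /itv0xP/andP[t0 tn].
  have -> : h n t = cpow t (p - 1) * cpow ((n.+2%:R - t) / n.+2%:R) (q + n.+2%:R - 1).
    by rewrite /h mulrBl divff ?gt_eqF.
  by rewrite cpow_div ?subr_gt0// cpowN /beta_integrand; ring.
have ih n : cintegrable (E n) (beta_integrand n.+2%:R p (q + n.+2%:R)).
  by apply: cintegrable_beta => //; exact: addn_re_gt0.
have fE n : cintegral D (f_ n) = cpow n.+2%:R p * beta_integral 1 p (q + n.+2%:R).
  rewrite -(cintegral_restrict _ (ED n)).
  rewrite (eq_cintegral (g := fun t => cpow n.+2%:R (- (q + n.+2%:R - 1)) *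
    beta_integrand n.+2%:R p (q + n.+2%:R) t)); last by move=> t /set_mem; exact: hE.
  rewrite (cintegralZ _ (mE n) (ih n)).
  rewrite -[cintegral _ _]/(beta_integral n.+2%:R p (q + n.+2%:R)).
  rewrite beta_integral_scale//;
    last exact: addn_re_gt0.
  by rewrite mulrA -cpowD; congr (cpow _ _ * _); ring.
rewrite (_ : (fun n => _) = (fun n => cintegral D (f_ n))); last exact/funext.
pose g t := (t `^ (re p - 1) * expR (- (2^-1 * t)))%:E.
have c2 : 0 < 2^-1 :> R by rewrite invr_gt0.
have [] // := @cdominated_convergence R D f_
  (fun t => cpow t (p - 1) * (expR (- t))%:C) g mD.
- move=> n; apply: cmeasurable_restrict => //.
  have [mr mi] := cintegrable_cmeasurable (cintegrableZ
    (cpow n.+2%:R (- (q + n.+2%:R - 1))) (mE n) (ih n)).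
  by split; [move: mr|move: mi]; apply: eq_measurable_fun => t /set_mem Et;
    rewrite hE.
- move=> t; rewrite /D /= in_itv /= andbT => t0.
  apply: (@ccvg_near _ _ (fun n => h n t)).
    apply: filterS (near_lt_nat t) => n tn.
    by rewrite /f_ mem_set// /E /= in_itv /= t0 tn.
  by apply: ccvgZ; exact: ccvg_cpow_exp.
- exact: integrable_gamma.
- move=> n t; rewrite /D /= in_itv /= andbT => t0.
  rewrite /g lee_fin /f_; case: ifPn => [/set_mem/itv0xP/andP[_ tn]|_]; last first.
    by rewrite normc0 mulr_ge0 ?powR_ge0 ?expR_ge0.
  have y0 : 0 < 1 - t / n.+2%:R by rewrite subr_gt0 ltr_pdivrMr// mul1r.
  rewrite /h normcM !normc_cpow// reB re1; apply: ler_wpM2l; rewrite ?powR_ge0//.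
  rewrite powRE// ler_expR reB reD re_nat re1.
  have e0 : 0 <= re q + n.+2%:R - 1 by rewrite -addrA addr_ge0 ?(ltW q0)// subr_ge0 ler1n.
  have l1 : ln (1 - t / n.+2%:R) <= - (t / n.+2%:R).
    by apply: le_ln1Dx; rewrite ltrN2 ltr_pdivrMr// mul1r.
  apply: (le_trans (ler_wpM2l e0 l1)).
  rewrite mulrN lerN2 [leRHS]mulrCA [leLHS]mulrC.
  apply: ler_wpM2l; rewrite ?(ltW t0)// ler_pdivlMr//.
  have : 2 <= n.+2%:R :> R by rewrite ler_nat.
  by move: (n.+2%:R : R) => N; lra.
Qed.

(** The reciprocal of Euler's approximation [n! n^z / (z (z+1) ... (z+n))] of
    Gamma: unlike the approximation itself, it is also meaningful at the poles. *)
Definition euler_seq z n := pochhammer z n.+1 / (n`!%:R * cpow n%:R z).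

Lemma ccvg_euler_seqV p : 0 < re p ->
  ccvg (fun n => (euler_seq p n)^-1) (euler_integral p).
Proof.
move=> p0; apply/(ccvg_shift 2).
rewrite (_ : (fun n => _) =
  (fun n => cpow n.+2%:R p * beta_integral 1 p (1 + n.+2%:R))).
  by apply: euler_limit_integral => //; rewrite re1.
apply/funext => n; rewrite addn2 /euler_seq.
have r1 : 0 < re (1 : R[i]) by rewrite re1.
have p1 : 0 < re (p + 1) by rewrite reD addr_gt0.
have := beta_integralDn n.+2 (@ltr01 R) p0 r1.
rewrite pochhammer1 rmorph1 expr1n mulr1 beta_integral_r1// => e.
apply: (mulfI (pochhammer_neq0 n.+2 p1)); rewrite [RHS]mulrCA e.
rewrite [pochhammer p _]pochhammerSl invf_div; field.
by rewrite (pochhammer_neq0 n.+2 p1) (re_gt0_neq0 p0).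
Qed.

Lemma euler_seq_rec z n : (0 < n)%N -> z + n.+1%:R != 0 ->
  euler_seq z n = z * euler_seq (z + 1) n * (n%:R / (z + n.+1%:R)).
Proof.
move=> n0 zn; have n0' : 0 < n%:R :> R by rewrite ltr0n.
rewrite /euler_seq [pochhammer z _]pochhammerSl pochhammerSr cpowD cpowr1//.
have -> : z + 1 + n%:R = z + n.+1%:R by rewrite -nat1r addrA.
rewrite -natC; field.
by rewrite nat1r zn cpow_neq0 !pnatr_eq0 -!lt0n n0 fact_gt0.
Qed.

(** [|1 + p h|^2 = 1 + (2 h Re p + |p|^2 h^2)], and [1 + u <= exp u]. *)
Lemma normc_one_add_le p (h : R) : 
  normc (1 + p * h%:C) <= expR (re p * h + normc p ^+ 2 / 2 * h ^+ 2).
Proof.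
rewrite -ler_sqr ?nnegrE ?normc_ge0 ?expR_ge0// -expRM_natl.
rewrite (normc_def2 (1 + _)) reD imD re1 im1 reMr imMr add0r.
apply: (le_trans _ (expR_ge1Dx _)).
rewrite normc_def2 le_eqVlt; apply/orP; left; apply/eqP; by field.
Qed.

(** With [h = 1 / (n + 2)], the ratio of the two terms is
    [(1 + p h) (1 - h)^p]: the first order terms in [h] cancel, and [h^2] is
    less than the telescoping difference [1 / (n + 1) - 1 / (n + 2)]. *)
Lemma euler_seq_ratio_le p n : 0 < re p ->
  normc (euler_seq p n.+2) <= normc (euler_seq p n.+1) *
    expR (normc p ^+ 2 / 2 * (n.+1%:R^-1 - n.+2%:R^-1)).
Proof.
move=> p0; pose h : R := n.+2%:R^-1.
have h0 : 0 < h by rewrite invr_gt0.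
have -> : euler_seq p n.+2 =
    euler_seq p n.+1 * ((1 + p * h%:C) * cpow (1 - h) p).
  have -> : 1 - h = n.+1%:R / n.+2%:R.
    rewrite /h -(natr1 n.+1); have : 0 < n.+1%:R :> R by [].
    by move: (n.+1%:R : R) => N N0; field; rewrite gt_eqF// addr_gt0.
  have -> : h%:C = n.+2%:R^-1 :> R[i] by rewrite natC -fmorphV.
  rewrite cpow_div// /euler_seq pochhammerSr factS natrM.
  have : n.+2%:R != 0 :> R[i] by rewrite pnatr_eq0.
  have : n.+1`!%:R != 0 :> R[i] by rewrite pnatr_eq0 -lt0n fact_gt0.
  move: (n.+2%:R : R[i]) (n.+1`!%:R : R[i]) (cpow_neq0 n.+1%:R p)
    (cpow_neq0 n.+2%:R p) => N F c1 c2 F0 N0.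
  by field; rewrite F0 N0 c1 c2.
rewrite normcM; apply: ler_wpM2l; first exact: normc_ge0.
rewrite normcM normc_cpow; last by rewrite subr_gt0 invf_lt1// ltr1n.
have h1 : (1 - h) `^ re p <= expR (- (re p * h)).
  rewrite powRE; last by rewrite subr_gt0 invf_lt1// ltr1n.
  rewrite ler_expR -mulrN; apply: ler_wpM2l; first exact: ltW.
  by apply: le_ln1Dx; rewrite ltrN2 invf_lt1// ltr1n.
apply: le_trans (ler_pM _ _ (normc_one_add_le p h) h1) _;
  rewrite ?normc_ge0 ?powR_ge0//.
rewrite -expRD ler_expR addrAC subrr add0r.
apply: ler_wpM2l; first by rewrite divr_ge0 ?sqr_ge0.
have -> : n.+1%:R^-1 - n.+2%:R^-1 = (n.+1%:R * n.+2%:R)^-1 :> R.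
  rewrite -(natr1 n.+1); have : 0 < n.+1%:R :> R by [].
  by move: (n.+1%:R : R) => N N0; field; rewrite !gt_eqF// addr_gt0.
rewrite /h exprVn lef_pV2 ?posrE ?mulr_gt0 ?exprn_gt0//.
by rewrite expr2 ler_pM2r// ler_nat.
Qed.

Lemma euler_seq_bounded p : 0 < re p ->
  exists2 C, 0 < C & forall n, normc (euler_seq p n.+1) <= C.
Proof.
move=> p0; pose K := normc p ^+ 2 / 2.
have K0 : 0 <= K by rewrite divr_ge0 ?sqr_ge0.
have H n : normc (euler_seq p n.+1) <=
    normc (euler_seq p 1) * expR (K * (1 - n.+1%:R^-1)).
  elim: n => [|n IH]; first by rewrite invr1 subrr mulr0 expR0 mulr1.
  apply: (le_trans (euler_seq_ratio_le n p0)).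
  apply: (le_trans (ler_wpM2r (expR_ge0 _) IH)).
  rewrite -[leLHS]mulrA -expRD -mulrDr; apply: ler_wpM2l; first exact: normc_ge0.
  by rewrite addrA subrK.
exists (normc (euler_seq p 1) * expR K + 1).
  by rewrite ltr_wpDl// mulr_ge0 ?normc_ge0 ?expR_ge0.
move=> n; apply: (le_trans (H n)); apply: (@le_trans _ _ (normc (euler_seq p 1) * expR K)).
  apply: ler_wpM2l; first exact: normc_ge0.
  by rewrite ler_expR ler_piMr// gerBl invr_ge0.
by rewrite lerDl.
Qed.

(** The reciprocals of a bounded sequence cannot tend to 0. *)
Lemma euler_integral_neq0 p : 0 < re p -> euler_integral p != 0.
Proof.
move=> p0; have [C C0 HC] := euler_seq_bounded p0.
apply/eqP => e0; have := ccvg_euler_seqV p0; rewrite e0.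
move=> /ccvg_dist0 /cvgr0Pnorm_lt /(_ C^-1); rewrite invr_gt0 => /(_ C0) [N _ H].
have := H N.+1 (leqnSn N); rewrite subr0 ger0_norm ?normc_ge0// normcV.
rewrite ltNge => /negP; apply; rewrite lef_pV2 ?posrE//.
rewrite normc_gt0 /euler_seq mulf_neq0 ?pochhammer_neq0// invr_neq0//.
by rewrite mulf_neq0 ?cpow_neq0// pnatr_eq0 -lt0n fact_gt0.
Qed.

Lemma ccvg_nat_ratio z : ccvg (fun n => n%:R / (z + n.+1%:R)) 1.
Proof.
apply/(ccvg_shift 2).
rewrite (_ : (fun n => _) = (fun n => (1 + (z + 1) * (n.+2%:R^-1)%:C)^-1)).
  rewrite -[X in ccvg _ X](_ : (1 + (z + 1) * 0%:C)^-1 = 1); last first.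
    by rewrite mulr0 addr0 invr1.
  apply: ccvgV; first by rewrite mulr0 addr0 oner_neq0.
  apply: ccvgD; first exact: ccvg_cst.
  apply: ccvgZ; apply: ccvg_real; exact: cvg_invn2.
apply/funext => n; rewrite addn2 -[LHS]invf_div; congr (_^-1).
have -> : (n.+2%:R^-1)%:C = n.+2%:R^-1 :> R[i] by rewrite natC fmorphV.
have -> : n.+3%:R = n.+2%:R + 1 :> R[i] by rewrite natr1.
have : n.+2%:R != 0 :> R[i] by rewrite pnatr_eq0.
by move: (n.+2%:R : R[i]) => N N0; field.
Qed.

Lemma near_addn_neq0 z : \forall n \near \oo, z + n.+1%:R != 0.
Proof.
exists (Num.truncn (- re z)) => // n /= h; apply/re_gt0_neq0.
rewrite reD re_nat -ltrBlDl sub0r; apply: lt_le_trans (truncnS_gt _) _.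
by rewrite ler_nat ltnS.
Qed.

Lemma ccvg_euler_seq_rec z l : ccvg (euler_seq (z + 1)) l ->
  ccvg (euler_seq z) (z * l).
Proof.
move=> cl; rewrite -[z * l]mulr1.
apply: ccvg_near (ccvgM (ccvgZ z cl) (ccvg_nat_ratio z)).
have n0 : \forall n \near \oo, (0 < n)%N by exists 1.
by apply: filterS2 n0 (near_addn_neq0 z) => n; exact: euler_seq_rec.
Qed.

Lemma cGamma_euler p : 0 < re p -> cGamma p = euler_integral p.
Proof. by move=> p0; rewrite /cGamma p0. Qed.

Lemma cGamma_neq0 p : 0 < re p -> cGamma p != 0.
Proof. by move=> p0; rewrite cGamma_euler// euler_integral_neq0. Qed.

Lemma ccvg_euler_seq_pos p : 0 < re p -> ccvg (euler_seq p) (cGamma p)^-1.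
Proof.
move=> p0; rewrite cGamma_euler//.
have := ccvgV (euler_integral_neq0 p0) (ccvg_euler_seqV p0).
by apply: ccvg_near; apply: nearW => n; rewrite invrK.
Qed.

(** In the form [1 / Gamma(z) = z / Gamma(z + 1)] the functional equation also
    holds at the poles. *)
Lemma cGammaV_rec z : (cGamma z)^-1 = z * (cGamma (z + 1))^-1.
Proof.
have [z0|z0] := ltP 0 (re z).
  apply: (ccvg_unique (ccvg_euler_seq_pos z0)).
  apply/ccvg_euler_seq_rec/ccvg_euler_seq_pos.
  by rewrite reD re1 addr_gt0.
rewrite {1}/cGamma ltNge z0 /=.
pose m := Num.truncn (- re z).
have /andP[m1 m2] : m%:R <= - re z < m.+1%:R.
  by apply: truncn_itv; rewrite oppr_ge0.
have -> : cGamma (z + 1) = euler_integral (z + 1 + m%:R) / pochhammer (z + 1) m.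
  rewrite /cGamma reD re1; case: ifPn => [z1|].
    have -> : m = 0%N.
      by apply/eqP; rewrite -leqn0 -ltnS -(ltr_nat R); lra.
    by rewrite pochhammer0 divr1 addr0.
  rewrite -leNgt => z1.
  suff -> : (Num.truncn (- (re z + 1))).+1 = m by [].
  case: (m) m1 m2 => [|k] k1 k2; first by exfalso; lra.
  congr _.+1; apply: truncn_def.
  by move: k1 k2; rewrite -(natr1 k.+1) -(natr1 k); lra.
rewrite -/m pochhammerSl !invf_div -mulrA; congr (_ * (_ / euler_integral _)).
by rewrite -addrA nat1r.
Qed.

(** The functional equation descends from the half-plane [0 < Re z]; at a pole
    the limit is 0, which is the convention for the reciprocal. *)
Lemma ccvg_euler_seq z : ccvg (euler_seq z) (cGamma z)^-1.
Proof.
have [m] : exists m : nat, 0 < re (z + m%:R).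
  exists (Num.truncn (- re z)).+1; rewrite reD re_nat -ltrBlDl sub0r.
  exact: truncnS_gt.
elim: m z => [|m IH] z; first by rewrite addr0; exact: ccvg_euler_seq_pos.
rewrite -nat1r addrA => /IH h; rewrite cGammaV_rec.
exact: ccvg_euler_seq_rec.
Qed.

End EulerLimit.


(** * The Beta integral as a quotient of Gamma values *)

Section BetaGamma.
Context {R : realType}.
Implicit Types (a b c p q z : R[i]).

(** By the recurrence, [n^p B(p, q + n)] is [B(p, q)] times a quotient of
    Pochhammer symbols. The left-hand side tends to Gamma p, and Euler's limit
    gives that the quotient tends to [Gamma (p + q) / Gamma q]. *)
Lemma beta_integral_Gamma p q : 0 < re p -> 0 < re q ->
  beta_integral 1 p q = cGamma p * cGamma q / cGamma (p + q).
Proof.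
move=> p0 q0.
have pq0 : 0 < re (p + q) by rewrite reD addr_gt0.
have l1 := euler_limit_integral p0 q0; rewrite -cGamma_euler// in l1.
have l2 := ccvgM (ccvg_euler_seq_pos q0) (ccvg_euler_seqV pq0).
have l3 := ccvgM (ccvg_nat_ratio (q - 1)) (ccvgV (oner_neq0 _) (ccvg_nat_ratio (p + q - 1))).
have l4 := (ccvg_shift 2 _ _).2 (ccvgM l2 l3).
have := ccvg_unique l1 (ccvg_near _ (ccvgM l4 (ccvg_cst (beta_integral 1 p q)))).
rewrite -cGamma_euler// invr1 !mulr1 => ->.
  by field; rewrite !cGamma_neq0.
apply: nearW => n; rewrite addn2.
have := beta_integralDn n.+2 (@ltr01 R) p0 q0; rewrite rmorph1 expr1n mulr1 => e.
have P0 := pochhammer_neq0 n.+2 pq0.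
apply: (mulfI P0); rewrite mulrCA e /euler_seq !(pochhammerSr _ n.+2) cpowD.
have -> : q - 1 + n.+3%:R = q + n.+2%:R by rewrite -(natr1 n.+2); ring.
have -> : p + q - 1 + n.+3%:R = p + q + n.+2%:R by rewrite -(natr1 n.+2); ring.
have : n.+2%:R != 0 :> R[i] by rewrite pnatr_eq0.
have : n.+2`!%:R != 0 :> R[i] by rewrite pnatr_eq0 -lt0n fact_gt0.
move: P0 (re_gt0_neq0 (addn_re_gt0 n.+2 q0)) (re_gt0_neq0 (addn_re_gt0 n.+2 pq0))
  (cpow_neq0 n.+2%:R p) (cpow_neq0 n.+2%:R q).
move: (pochhammer (p + q) _) (cpow _ p) (cpow _ q) (_`!%:R : R[i])
  (n.+2%:R : R[i]) => P cp cq F N P0 h1 h2 cp0 cq0 F0 N0.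
by field; rewrite P0 h1 h2 cp0 cq0 F0 N0.
Qed.

End BetaGamma.

(** * Growth of Pochhammer symbols *)

Section PochhammerBounds.
Context {R : realType}.
Implicit Types (a b c p q z : R[i]).

Lemma ccvg_bounded (u : nat -> R[i]) l : ccvg u l ->
  exists2 C, 0 < C & forall n, normc (u n) <= C.
Proof.
move=> /ccvg_normc ul.
have [M [_ HM]] := cvg_seq_bounded (cvgP _ ul).
exists (`|M| + 1); first by rewrite ltr_pwDr.
move=> n; have := HM (`|M| + 1); rewrite (le_lt_trans (ler_norm M)) ?ltrDl//.
by move=> /(_ isT n); rewrite /= ger0_norm ?normc_ge0//; exact.
Qed.

Lemma normc_pochhammer a n : normc (pochhammer a n.+2) =
  normc (euler_seq a n.+1) * (n.+1`!%:R * n.+1%:R `^ re a).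
Proof.
rewrite /euler_seq normc_div normcM normc_nat normc_cpow// divfK//.
Qed.

Lemma pochhammer_le a : exists2 C, 0 < C &
  forall n, normc (pochhammer a n.+2) <= C * (n.+1`!%:R * n.+1%:R `^ re a).
Proof.
have [C C0 HC] := ccvg_bounded (ccvg_euler_seq a); exists C => // n.
by rewrite normc_pochhammer ler_wpM2r// mulr_ge0 ?powR_ge0.
Qed.

Lemma pochhammerV_le p : 0 < re p -> exists2 C, 0 < C &
  forall n, (normc (pochhammer p n.+2))^-1 <= C / (n.+1`!%:R * n.+1%:R `^ re p).
Proof.
move=> p0; have [C C0 HC] := ccvg_bounded (ccvg_euler_seqV p0); exists C => // n.
rewrite normc_pochhammer invfM -normcV; by apply: ler_wpM2r; rewrite // invr_ge0 mulr_ge0 ?powR_ge0.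
Qed.

(** The term of the hypergeometric series 2F1(a, b; c; 1). *)
Definition gauss_term a b c n := pochhammer a n * pochhammer b n /
  (pochhammer c n * n`!%:R).

(** Euler's limit makes [(a)_(n+2)] of order [(n+1)! (n+1)^(Re a)]. *)
Lemma gauss_term_le a b c : 0 < re c -> exists2 C, 0 < C &
  forall n, normc (gauss_term a b c n.+2) <=
    C * n.+1%:R `^ (re a + re b - re c - 1).
Proof.
move=> c0; have [A A0 HA] := pochhammer_le a.
have [B B0 HB] := pochhammer_le b; have [D D0 HD] := pochhammerV_le c0.
exists (A * B * D) => [|n]; first by rewrite !mulr_gt0.
rewrite /gauss_term normc_div !normcM invfM normc_nat.
have F0 : 0 < n.+1`!%:R :> R by rewrite ltr0n fact_gt0.
have P0 (s : R) : 0 < n.+1%:R `^ s by rewrite powR_gt0.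
apply: (@le_trans _ _ ((A * (n.+1`!%:R * n.+1%:R `^ re a)) *
  (B * (n.+1`!%:R * n.+1%:R `^ re b)) *
  ((D / (n.+1`!%:R * n.+1%:R `^ re c)) * (n.+1 * n.+1`!)%:R^-1))).
  apply: ler_pM; rewrite ?mulr_ge0 ?invr_ge0 ?normc_ge0//.
    by apply: ler_pM; rewrite ?normc_ge0.
  apply: ler_pM; rewrite ?invr_ge0 ?normc_ge0//.
  rewrite lef_pV2 ?posrE ?ltr0n ?muln_gt0 ?fact_gt0//.
  by rewrite ler_nat factS leq_mul2r leqnSn orbT.
rewrite le_eqVlt; apply/orP; left; apply/eqP.
rewrite natrM; have -> : n.+1%:R `^ (re a + re b - re c - 1) =
    n.+1%:R `^ re a * n.+1%:R `^ re b / n.+1%:R `^ re c / n.+1%:R :> R.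
  by rewrite !powRD ?pnatr_eq0 ?implybT// !powRN powRr1.
have : 0 < n.+1%:R :> R by [].
move: F0 (P0 (re c)) => /lt0r_neq0 + /lt0r_neq0 + /lt0r_neq0.
move: (n.+1`!%:R : R) (n.+1%:R `^ re c) (n.+1%:R `^ re a) (n.+1%:R `^ re b)
  (n.+1%:R : R) => F c' a' b' N F0 C0 N0.
by field; rewrite F0 C0 N0.
Qed.

(** Telescoping: [m^(-d-1)] is at most [((m-1)^(-d) - m^(-d)) / d], because
    [ln (1 - 1/m) <= - 1/m]. *)
Lemma zeta_summable (d : R) : 0 < d ->
  forall n, \sum_(0 <= k < n) k.+1%:R `^ (- d - 1) <= 1 + d^-1.
Proof.
move=> d0.
have step n : n.+2%:R `^ (- d - 1) <=
    d^-1 * (n.+1%:R `^ (- d) - n.+2%:R `^ (- d)) :> R.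
  have N0 : 0 < n.+2%:R :> R by [].
  rewrite mulrC ler_pdivlMr// powRD ?pnatr_eq0 ?implybT// powRN powR_inv1//.
  rewrite lerBrDr.
  have h : n.+2%:R `^ (- d) * expR (d / n.+2%:R) <= n.+1%:R `^ (- d) :> R.
    rewrite !powRE// -expRD ler_expR.
    have -> : n.+1%:R = n.+2%:R * (1 - n.+2%:R^-1) :> R.
      by rewrite mulrBr mulr1 divff ?gt_eqF// -(natr1 n.+1) addrK.
    have y0 : 0 < 1 - n.+2%:R^-1 :> R by rewrite subr_gt0 invf_lt1// ltr1n.
    rewrite lnM ?posrE// mulrDr lerD2l !mulNr -mulrN; apply: ler_wpM2l; first exact: ltW.
    rewrite lerNr; apply: le_ln1Dx; by rewrite ltrN2 invf_lt1// ltr1n.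
  apply: le_trans h; rewrite -powRN.
  apply: (le_trans _ (ler_wpM2l (powR_ge0 _ _) (expR_ge1Dx _))).
  rewrite le_eqVlt; apply/orP; left; apply/eqP.
  by move: (_ `^ _) (n.+2%:R^-1 : R) => u w; ring.
have H n : \sum_(0 <= k < n.+1) k.+1%:R `^ (- d - 1) <=
    1 + d^-1 * (1 - n.+1%:R `^ (- d)) :> R.
  elim: n => [|n IH]; first by rewrite big_nat1 powR1 subrr mulr0 addr0.
  rewrite big_nat_recr//=; apply: (le_trans (lerD IH (step n))).
  by rewrite -addrA -mulrDr addrA subrK.
case=> [|n]; first by rewrite big_nil addr_ge0// invr_ge0 ltW.
apply: (le_trans (H n)); rewrite lerD2l ler_piMr ?invr_ge0 ?ltW// gerBl powR_ge0.
Qed.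

Lemma sum_shift2_bounded (u v : nat -> R) (M : R) : (forall n, 0 <= u n) ->
  (forall n, u n.+2 <= v n) -> (forall n, \sum_(0 <= k < n) v k <= M) ->
  forall n, \sum_(0 <= k < n) u k <= u 0%N + u 1%N + M.
Proof.
move=> u0 uv vM.
have M0 : 0 <= M by have := vM 0%N; rewrite big_nil.
case=> [|[|n]].
- by rewrite big_nil !addr_ge0.
- by rewrite big_nat1 -addrA lerDl addr_ge0.
rewrite big_nat_recl// big_nat_recl//= addrA lerD2l.
by apply: le_trans (vM n); apply: ler_sum.
Qed.

End PochhammerBounds.

(** * Gauss's summation theorem *)

Section GaussSum.
Context {R : realType}.
Implicit Types (a b c p q z : R[i]).

Lemma gauss_term_series_le a b c : 0 < re c -> 0 < re (c - a - b) ->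
  exists M, forall n, \sum_(0 <= k < n) normc (gauss_term a b c k) <= M.
Proof.
move=> c0 d0; have [C C0 HC] := gauss_term_le a b c0.
pose d := re (c - a - b).
exists (normc (gauss_term a b c 0) + normc (gauss_term a b c 1) + C * (1 + d^-1)).
apply: (sum_shift2_bounded (v := fun k => C * k.+1%:R `^ (- d - 1))).
- by move=> n; exact: normc_ge0.
- move=> n; apply: le_trans (HC n) _; rewrite le_eqVlt; apply/orP; left.
  by apply/eqP; congr (_ * _ `^ _); rewrite /d !reB; ring.
- by move=> n; rewrite -mulr_sumr ler_pM2l// zeta_summable.
Qed.

Lemma gauss_term_series_cvg a b c : 0 < re c -> 0 < re (c - a - b) ->
  ccvg (series (gauss_term a b c)) (csum (gauss_term a b c)).
Proof.
move=> c0 d0; have [M HM] := gauss_term_series_le c0 d0.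
apply/normc_series_cvg; apply: (nneg_series_cvg (M := M)) => n.
  exact: normc_ge0.
exact: HM.
Qed.

Lemma gauss_term_nat_cvg0 a b c : 0 < re c -> 0 < re (c - a - b) ->
  ccvg (fun n => n%:R * gauss_term a b c n) 0.
Proof.
move=> c0 d0; have [C C0 HC] := gauss_term_le a b c0.
pose d := re (c - a - b).
apply/(ccvg_shift 2).
apply: (@ccvg_squeeze _ _ _ (fun n => 2 * C * (n.+1%:R^-1) `^ d)).
  apply: nearW => n; rewrite subr0 addn2 normcM normc_nat.
  have N0 : 0 < n.+1%:R :> R by [].
  apply: (@le_trans _ _ (2 * n.+1%:R * (C * n.+1%:R `^ (- d - 1)))).
    apply: ler_pM; rewrite ?normc_ge0//.
      by rewrite -natrM ler_nat mul2n -addnn addSn ltnS addnS ltnS leq_addl.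
    apply: le_trans (HC n) _; rewrite le_eqVlt; apply/orP; left.
    by apply/eqP; congr (_ * _ `^ _); rewrite /d !reB; ring.
  rewrite powRD ?pnatr_eq0 ?implybT// powRN powR_inv1//.
  rewrite le_eqVlt; apply/orP; left; apply/eqP.
  have -> : n.+1%:R^-1 `^ d = (n.+1%:R `^ d)^-1 :> R.
    by rewrite !powRE ?invr_gt0// lnV ?posrE// mulrN expRN.
  have : n.+1%:R `^ d != 0 :> R by rewrite gt_eqF// powR_gt0.
  move: (n.+1%:R `^ d) (n.+1%:R : R) N0 => P N N0 P0.
  by field; rewrite P0 gt_eqF.
rewrite -(mulr0 (2 * C)); apply: cvgM; first exact: cvg_cst.
apply: cvg_powR0; first exact: d0.
  by move=> n; rewrite invr_gt0.
exact: cvg_harmonic.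
Qed.

Lemma gauss_term_contiguous a b c n : 0 < re c ->
  c * ((c - a - b) * gauss_term a b c n +
       (n.+1%:R * gauss_term a b c n.+1 - n%:R * gauss_term a b c n)) =
  (c - a) * (c - b) * gauss_term a b (c + 1) n.
Proof.
move=> c0; rewrite /gauss_term.
have cn0 := re_gt0_neq0 (addn_re_gt0 n c0); have c_neq0 := re_gt0_neq0 c0.
have -> : pochhammer (c + 1) n = pochhammer c n * (c + n%:R) / c.
  by rewrite -pochhammerSr pochhammerSl mulrAC divff// mul1r.
rewrite !pochhammerSr factS natrM -(natr1 n).
have := pochhammer_neq0 n c0.
have : n`!%:R != 0 :> R[i] by rewrite pnatr_eq0 -lt0n fact_gt0.
have : n%:R + 1 != 0 :> R[i] by rewrite natr1 pnatr_eq0.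
move: (pochhammer c n) (pochhammer a n) (pochhammer b n) (n`!%:R : R[i])
  (n%:R : R[i]) cn0 => P A B F N cn0 N0 F0 P0.
by field; rewrite P0 F0 N0 cn0 c_neq0.
Qed.

(** Summation of the relation between the terms: the differences telescope, and
    [n] times the n-th term tends to 0. *)
Lemma gauss_sum_contiguous a b c : 0 < re c -> 0 < re (c - a - b) ->
  c * (c - a - b) * csum (gauss_term a b c) =
  (c - a) * (c - b) * csum (gauss_term a b (c + 1)).
Proof.
move=> c0 d0.
have c1 : 0 < re (c + 1) by rewrite reD addr_gt0.
have d1 : 0 < re (c + 1 - a - b).
  by move: d0; rewrite !reB reD re1; lra.
have l1 := ccvgZ ((c - a) * (c - b)) (gauss_term_series_cvg c1 d1).
have l2 := ccvgZ c (ccvgD (ccvgZ (c - a - b) (gauss_term_series_cvg c0 d0))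
  (gauss_term_nat_cvg0 c0 d0)).
rewrite addr0 mulrA in l2; apply: (ccvg_unique l2 (ccvg_near _ l1)).
apply: nearW; elim=> [|n IH].
  by rewrite /series /= !big_geq// !(mulr0, mul0r, addr0).
rewrite /series /= !big_nat_recr//= in IH *.
rewrite [RHS]mulrDr -gauss_term_contiguous// -IH; ring.
Qed.

Lemma gauss_sum_shift a b c n : 0 < re c -> 0 < re (c - a - b) ->
  csum (gauss_term a b c) =
  pochhammer (c - a) n * pochhammer (c - b) n /
  (pochhammer c n * pochhammer (c - a - b) n) *
  csum (gauss_term a b (c + n%:R)).
Proof.
move=> c0 d0; elim: n => [|n IH].
  by rewrite !pochhammer0 addr0 !mul1r invr1 mul1r.
have cn0 := addn_re_gt0 n c0; have dn0 := addn_re_gt0 n d0.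
have dn0' : 0 < re (c + n%:R - a - b).
  by move: dn0; rewrite !(reB, reD); lra.
have := gauss_sum_contiguous cn0 dn0'.
rewrite IH -[n.+1]addn1 natrD addrA addn1 !pochhammerSr.
have -> : c + n%:R - a - b = c - a - b + n%:R by ring.
have -> : c + n%:R - a = c - a + n%:R by ring.
have -> : c + n%:R - b = c - b + n%:R by ring.
move: (pochhammer_neq0 n c0) (pochhammer_neq0 n d0) (re_gt0_neq0 cn0)
  (re_gt0_neq0 dn0) => P0 Q0 R0 S0 e.
apply: (mulfI R0); apply: (mulfI S0).
set F := csum (gauss_term a b (c + n%:R)) in e *.
transitivity (pochhammer (c - a) n * pochhammer (c - b) n /
  (pochhammer c n * pochhammer (c - a - b) n) *
  ((c + n%:R) * (c - a - b + n%:R) * F)); first by ring.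
rewrite e; field.
by rewrite P0 Q0 R0 S0.
Qed.

(** Each factor [c + j] of [(c)_(k+1)] has modulus at most that of [c + n + j];
    the quotient of the first factors, for [j = 0], is kept. *)
Lemma normc_gauss_term_shift_le a b c n k : 0 < re c ->
  normc (gauss_term a b (c + n%:R) k.+1) <=
  normc c / normc (c + n%:R) * normc (gauss_term a b c k.+1).
Proof.
move=> c0; rewrite /gauss_term !normc_div !normcM.
have cn0 := addn_re_gt0 n c0.
have mono m : normc (c + m%:R) <= normc (c + n%:R + m%:R).
  rewrite -ler_sqr ?nnegrE ?normc_ge0// !normc_def2 !reD !imD !re_nat !im_nat !addr0.
  rewrite lerD2r ler_sqr ?nnegrE ?addr_ge0 ?(ltW c0)//.
  by rewrite lerD2r lerDl.
have H m : normc c / normc (c + n%:R) * (normc (pochhammer c m.+1))^-1 >=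
           (normc (pochhammer (c + n%:R) m.+1))^-1.
  elim: m => [|m IH].
    rewrite !pochhammerSr !pochhammer0 !mul1r !addr0 mulrAC divff ?mul1r//.
    by rewrite normc_eq0 re_gt0_neq0.
  rewrite !(pochhammerSr _ m.+1) !normcM !invfM [leRHS]mulrA.
  apply: ler_pM => //; rewrite ?invr_ge0 ?normc_ge0//.
  rewrite lef_pV2 ?posrE ?normc_gt0 ?re_gt0_neq0//; exact: addn_re_gt0.
rewrite !invfM [leRHS]mulrCA !mulrA -!mulrA.
apply: ler_wpM2l; first exact: normc_ge0.
apply: ler_wpM2l; first exact: normc_ge0.
by rewrite !mulrA; apply: ler_wpM2r; rewrite ?invr_ge0 ?normc_ge0.
Qed.

Lemma gauss_sum_shift_cvg a b c : 0 < re c -> 0 < re (c - a - b) ->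
  ccvg (fun n => csum (gauss_term a b (c + n%:R))) 1.
Proof.
move=> c0 d0; have [M HM] := gauss_term_series_le c0 d0.
have M0 : 0 <= M by have := HM 0%N; rewrite big_nil.
apply/(ccvg_shift 1).
apply: (@ccvg_squeeze _ _ _ (fun n => normc c * M * n.+1%:R^-1)); last first.
  rewrite -(mulr0 (normc c * M)); apply: cvgM; first exact: cvg_cst.
  exact: cvg_harmonic.
apply: nearW => n; rewrite addn1.
have cn0 := addn_re_gt0 n.+1 c0.
have dn0 : 0 < re (c + n.+1%:R - a - b).
  by move: d0 (ler0n R n.+1); rewrite !(reB, reD) re_nat; lra.
have l := ccvg_normc (ccvgB (gauss_term_series_cvg cn0 dn0) (ccvg_cst 1)).
have cn1 : n.+1%:R <= normc (c + n.+1%:R).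
  apply: le_trans (normc_re _); rewrite reD re_nat ger0_norm ?addr_ge0 ?(ltW c0)//.
  by rewrite lerDr ltW.
apply: (cvgr_to_le l); exists 1%N => // -[|m] // _.
rewrite /series /= big_nat_recl// {1}/gauss_term !pochhammer0 fact0.
rewrite !mul1r invr1 addrAC subrr add0r.
apply: le_trans (normc_sum _ _ _) _.
apply: (@le_trans _ _ (\sum_(0 <= k < m) normc c / normc (c + n.+1%:R) *
    normc (gauss_term a b c k.+1))).
  by apply: ler_sum => k _; exact: normc_gauss_term_shift_le.
rewrite -mulr_sumr mulrAC -mulrA mulrAC -mulrA; apply: ler_wpM2l; first exact: normc_ge0.
rewrite mulrC; apply: ler_pM.
- by rewrite invr_ge0 normc_ge0.
- by apply: sumr_ge0 => k _; exact: normc_ge0.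
- by rewrite lef_pV2 ?posrE// normc_gt0 re_gt0_neq0.
- apply: le_trans (HM m.+1); rewrite big_nat_recl// lerDr; exact: normc_ge0.
Qed.

(** Iterating the contiguity relation [n] times turns the sum into a quotient of
    Pochhammer symbols times the sum with [c + n] in place of [c], which tends
    to 1. In the quotient the powers of [n] of Euler's limit cancel. As this
    limit is that of the reciprocal of Gamma, [c - a] and [c - b] may be
    poles. *)
Lemma gauss_sum a b c : 0 < re c -> 0 < re (c - a - b) ->
  csum (gauss_term a b c) =
  cGamma c * cGamma (c - a - b) / (cGamma (c - a) * cGamma (c - b)).
Proof.
move=> c0 d0.
have l1 := ccvgM (ccvgM (ccvg_euler_seq (c - a)) (ccvg_euler_seq (c - b)))
  (ccvgM (ccvg_euler_seqV c0) (ccvg_euler_seqV d0)).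
have l2 := (ccvg_shift 1 _ _).2 (gauss_sum_shift_cvg c0 d0).
have l3 := ccvgM l1 l2.
have := ccvg_unique (ccvg_cst (csum (gauss_term a b c))) (ccvg_near _ l3).
rewrite -!cGamma_euler// mulr1 => ->; first by rewrite invfM mulrC.
apply: nearW => n; rewrite (gauss_sum_shift n.+1 c0 d0) addn1; congr (_ * _).
rewrite /euler_seq.
have e : cpow n%:R (c - a) * cpow n%:R (c - b) =
         cpow n%:R c * cpow n%:R (c - a - b).
  by rewrite -!cpowD; congr cpow; ring.
have -> : cpow n%:R (c - b) =
    cpow n%:R c * cpow n%:R (c - a - b) / cpow n%:R (c - a).
  by rewrite -e mulrAC divff ?mul1r// cpow_neq0.
have : n`!%:R != 0 :> R[i] by rewrite pnatr_eq0 -lt0n fact_gt0.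
move: (pochhammer_neq0 n.+1 c0) (pochhammer_neq0 n.+1 d0) (cpow_neq0 n%:R c)
  (cpow_neq0 n%:R (c - a)) (cpow_neq0 n%:R (c - a - b)).
move: (pochhammer c _) (pochhammer (c - a) _) (pochhammer (c - b) _)
  (pochhammer (c - a - b) _) (cpow _ c) (cpow _ (c - a)) (cpow _ (c - a - b))
  (n`!%:R : R[i]) => P1 P2 P3 P4 u1 u2 u3 F h1 h2 h3 h4 h5 h6.
by field; rewrite h1 h2 h3 h4 h5 h6.
Qed.

End GaussSum.


(** * Saigo's integral of a power *)

Section SaigoPower.
Context {R : realType}.
Local Notation mu := (@lebesgue_measure R).
Local Notation mR := (measurableTypeR R).
Implicit Types (a b c p q z : R[i]) (x y t : R).

(** Geometric decay beats every power: with [e = - ln y], the factor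
    [y^(n+2)] is at most [exp (- e (n+1))], and [(e m)^K / K! <= exp (e m)]. *)
Lemma natr_powR_geometric (s y : R) : 0 < y < 1 ->
  exists2 C, 0 < C & forall n, n.+1%:R `^ s * y ^+ n.+2 <= C * n.+1%:R `^ (- 1 - 1).
Proof.
move=> /andP[y0 y1]; pose e := - ln y.
have e0 : 0 < e by rewrite oppr_gt0 ln_lt0// y0.
pose K := (Num.truncn (s + 2)).+1.
exists (K`!%:R / e ^+ K); first by rewrite divr_gt0 ?exprn_gt0// ltr0n fact_gt0.
move=> n; have N0 : 0 < n.+1%:R :> R by [].
have -> : - 1 - 1 = - 2 :> R by ring.
rewrite powRN ler_pdivlMr ?powR_gt0// mulrAC -powRD ?pnatr_eq0 ?implybT//.
have h1 : n.+1%:R `^ (s + 2) <= n.+1%:R ^+ K :> R.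
  rewrite -powR_mulrn//; apply: ler_powR; first by rewrite ler1n.
  exact/ltW/truncnS_gt.
have h2 : n.+1%:R ^+ K <= K`!%:R / e ^+ K * expR (e * n.+1%:R) :> R.
  rewrite mulrAC ler_pdivlMr ?exprn_gt0// mulrC -exprMn.
  by apply: expR_ge_pow; rewrite mulr_ge0 ?ltW.
have h3 : y ^+ n.+2 <= expR (- (e * n.+1%:R)).
  rewrite -{1}(lnK (y0 : y \is Num.pos)) -expRM_natl ler_expR /e mulNr opprK mulrC.
  by rewrite ler_wnM2l ?ler_nat// ltW// ln_lt0// y0.
apply: (le_trans (ler_pM _ _ (le_trans h1 h2) h3)); rewrite ?powR_ge0 ?exprn_ge0 ?(ltW y0)//.
by rewrite -[leLHS]mulrA -expRD subrr expR0 mulr1.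
Qed.

Lemma hyp2F1_cvg a b c y : 0 < re c -> 0 < y < 1 ->
  ccvg (series (fun n => pochhammer a n * pochhammer b n / pochhammer c n *
                 (y%:C ^+ n / n`!%:R))) (hyp2F1 a b c y%:C).
Proof.
move=> c0 y01; have /andP[y0 y1] := y01.
apply: normc_series_cvg.
have [C C0 HC] := gauss_term_le a b c0.
have [D D0 HD] := natr_powR_geometric (re a + re b - re c - 1) y01.
set u := fun n => normc _.
have uE n : u n = normc (gauss_term a b c n) * y ^+ n.
  rewrite /u /gauss_term invfM mulrA mulrCA [_ * (_ / _)]mulrC !normcM normcX normcC.
  by rewrite ger0_norm ?(ltW y0)//; ring.
apply: (nneg_series_cvg (M := u 0%N + u 1%N + C * D * (1 + 1^-1))).
  by move=> n; exact: normc_ge0.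
move=> n; apply: (sum_shift2_bounded (v := fun k => C * D * k.+1%:R `^ (- 1 - 1))).
- by move=> k; exact: normc_ge0.
- move=> k; rewrite uE.
  apply: (le_trans (ler_wpM2r _ (HC k))); first by rewrite exprn_ge0// ltW.
  by rewrite -!mulrA ler_pM2l.
- by move=> k; rewrite -mulr_sumr ler_pM2l ?mulr_gt0//; exact: zeta_summable.
Qed.

Lemma pochhammer_ratio_le q r : 0 < re r -> exists2 C, 0 < C &
  forall n, normc (pochhammer q n.+2 / pochhammer r n.+2) <=
    C * n.+1%:R `^ (re q - re r).
Proof.
move=> r0; have [A A0 HA] := pochhammer_le q; have [B B0 HB] := pochhammerV_le r0.
exists (A * B) => [|n]; first exact: mulr_gt0.
rewrite normc_div; apply: le_trans (ler_pM _ _ (HA n) (HB n)) _;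
  rewrite ?invr_ge0 ?normc_ge0//.
rewrite powRB ?pnatr_eq0 ?implybT//.
have : n.+1`!%:R != 0 :> R by rewrite pnatr_eq0 -lt0n fact_gt0.
have : n.+1%:R `^ re r != 0 :> R by rewrite gt_eqF// powR_gt0.
move: (n.+1`!%:R : R) (n.+1%:R `^ re r) (n.+1%:R `^ re q) => F u w u0 F0.
by rewrite le_eqVlt; apply/orP; left; apply/eqP; field; rewrite F0 u0.
Qed.

(** The hypergeometric kernel is expanded in powers of [1 - t/x], and each term
    integrates to a Beta integral. The moduli of the terms have integrals of
    order [m^(-d-1)] with [d = Re (rho + eta - beta)], so that the series may
    be integrated term by term; the result is a Gauss series at 1. *)
Lemma saigo_kernel_power (alpha beta eta rho : R[i]) x : 0 < x ->
  0 < re alpha -> 0 < re rho -> 0 < re (rho + eta - beta) ->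
  cintegrable `]0, x[
    (saigo_integrand alpha beta eta (fun t => cpow t (rho - 1)) x) /\
  cintegral `]0, x[
    (saigo_integrand alpha beta eta (fun t => cpow t (rho - 1)) x) =
  cpow x (rho + alpha - 1) * (cGamma alpha *
    (cGamma rho * cGamma (rho + eta - beta) /
     (cGamma (rho - beta) * cGamma (rho + alpha + eta)))).
Proof.
move=> x0 a0 r0 d0.
pose a := alpha + beta; pose b := - eta.
have mD : measurable (`]0, x[%classic : set mR) by exact: measurable_itv.
pose coef m := pochhammer a m * pochhammer b m / pochhammer alpha m / m`!%:R.
pose f m t := (coef m * (x%:C ^+ m)^-1) * beta_integrand x rho (alpha + m%:R) t.
have xC0 : x%:C != 0 :> R[i] by rewrite eq_complex /= gt_eqF.
have ra0 : 0 < re (rho + alpha) by rewrite reD addr_gt0.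
have fi m : cintegrable `]0, x[ (f m).
  by apply: cintegrableZ => //; apply: cintegrable_beta => //; exact: addn_re_gt0.
have fI m : cintegral `]0, x[ (f m) =
    beta_integral x rho alpha * gauss_term a b (rho + alpha) m.
  rewrite cintegralZ//; last by apply: cintegrable_beta => //; exact: addn_re_gt0.
  rewrite -[cintegral _ _]/(beta_integral x rho (alpha + m%:R)).
  have := beta_integralDn m x0 r0 a0.
  have P0 := pochhammer_neq0 m ra0; have Q0 := pochhammer_neq0 m a0.
  have F0 : m`!%:R != 0 :> R[i] by rewrite pnatr_eq0 -lt0n fact_gt0.
  have X0 : x%:C ^+ m != 0 by rewrite expf_neq0.
  move=> e; apply: (mulfI P0); rewrite [LHS]mulrCA e /gauss_term /coef.
  move: P0 Q0 X0 F0; move: (pochhammer (rho + alpha) m) (pochhammer alpha m)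
    (x%:C ^+ m) (m`!%:R : R[i]) => P Q X F P0 Q0 X0 F0.
  by field; rewrite P0 Q0 X0 F0.
have cF t : `]0, x[%classic t -> ccvg (series (fun m => f m t))
    (saigo_integrand alpha beta eta (fun t => cpow t (rho - 1)) x t).
  move=> /itv0xP/andP[t0 tx].
  have y01 : 0 < 1 - t / x < 1.
    by rewrite subr_gt0 ltr_pdivrMr// mul1r tx/= gtrBl divr_gt0.
  have h := ccvgZ (cpow (x - t) (alpha - 1) * cpow t (rho - 1))
    (hyp2F1_cvg a b a0 y01).
  rewrite /saigo_integrand mulrAC.
  apply: ccvg_near h; apply: nearW => n.
  rewrite /series /= mulr_sumr; apply: eq_bigr => m _.
  rewrite /f /coef /beta_integrand.
  have -> : 1 - t / x = (x - t) / x by rewrite mulrBl divff ?gt_eqF.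
  rewrite rmorphM fmorphV exprMn exprVn.
  have -> : alpha + m%:R - 1 = alpha - 1 + m%:R by ring.
  rewrite (cpowD (x - t) _ m%:R) cpow_nat ?subr_gt0// rmorphXn /=; ring.
(* the integral of the modulus of a term is a Beta integral with real
   parameters *)
pose p : R[i] := (re rho)%:C; pose q : R[i] := (re alpha)%:C.
have p0 : 0 < re p by []. have q0 : 0 < re q by [].
have pq0 : 0 < re (p + q) by rewrite reD addr_gt0.
have [C C0 HC] := gauss_term_le a b a0.
have [E E0 HE] := pochhammer_ratio_le q pq0.
pose u m := \int[mu]_(t in `]0, x[) normc (f m t).
pose B := normc (beta_integral x p q).
have uE m : u m <= normc (gauss_term a b alpha m) *
    normc (pochhammer q m / pochhammer (p + q) m) * B.
  rewrite /u; under eq_Rintegral do rewrite normcM.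
  rewrite RintegralZl//; last first.
    apply: cintegrable_normc => //; apply: cintegrable_beta => //.
    exact: addn_re_gt0.
  rewrite integral_normc_beta//.
  have -> : (re (alpha + m%:R))%:C = q + m%:R :> R[i].
    by rewrite reD re_nat rmorphD rmorph_nat.
  rewrite -/p; have e := beta_integralDn m x0 p0 q0.
  apply: (le_trans (ler_wpM2l (normc_ge0 _) (le_trans (ler_norm _) (normc_re _)))).
  rewrite -normcM -!normcM.
  have -> : beta_integral x p (q + m%:R) =
     pochhammer q m / pochhammer (p + q) m * x%:C ^+ m * beta_integral x p q.
    apply: (mulfI (pochhammer_neq0 m pq0)); rewrite e.
    have := pochhammer_neq0 m pq0; move: (pochhammer (p + q) m) => P P0.
    by field.
  rewrite le_eqVlt; apply/orP; left; apply/eqP; congr normc.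
  rewrite /gauss_term /coef invfM.
  have := expf_neq0 m xC0; move: (x%:C ^+ m) => X X0.
  rewrite -!mulrA; congr (_ * (_ * (_ * (_ * _)))).
  rewrite mulrCA; congr (_ * _); rewrite mulrCA; congr (_ * _).
  by rewrite mulKf.
pose d := re (rho + eta - beta).
have uM n : \sum_(0 <= k < n) u k <= u 0%N + u 1%N + C * E * B * (1 + d^-1).
  apply: (sum_shift2_bounded (v := fun k => C * E * B * k.+1%:R `^ (- d - 1))).
  - by move=> m; apply: Rintegral_ge0 => t _; exact: normc_ge0.
  - move=> m; apply: (le_trans (uE m.+2)).
    rewrite -mulrA; rewrite [leRHS](_ : _ = C * m.+1%:R `^ (re a + re b - re alpha - 1) *
      (E * m.+1%:R `^ (re q - re (p + q)) * B)); last first.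
      have -> : - d - 1 = (re a + re b - re alpha - 1) + (re q - re (p + q)).
        by rewrite /d /a /b !(reD, reN) /=; ring.
      rewrite (@powRD _ _ (re a + re b - re alpha - 1)) ?pnatr_eq0 ?implybT//.
      by move: (_ `^ _) (_ `^ _) => v w; ring.
    apply: ler_pM; rewrite ?mulr_ge0 ?normc_ge0//.
    by apply: ler_wpM2r; rewrite ?normc_ge0.
  - move=> m; rewrite -mulr_sumr; apply: ler_wpM2l; last exact: zeta_summable.
    by rewrite !mulr_ge0 ?normc_ge0// ltW.
have [iF cvF] := cintegral_series mD fi uM cF.
split => //.
have gd : 0 < re (rho + alpha - a - b).
  by move: d0; rewrite /a /b !(reD, reN) /=; lra.
have := ccvgZ (beta_integral x rho alpha) (gauss_term_series_cvg ra0 gd).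
rewrite gauss_sum// beta_integral_scale// beta_integral_Gamma// => l.
rewrite (ccvg_unique cvF (ccvg_near _ l)); last first.
  apply: nearW => n; rewrite /series /= mulr_sumr; apply: eq_bigr => m _.
  by rewrite fI beta_integral_scale// beta_integral_Gamma.
have -> : rho + alpha - a - b = rho + eta - beta by rewrite /a /b; ring.
have -> : rho + alpha - a = rho - beta by rewrite /a; ring.
have -> : rho + alpha - b = rho + alpha + eta by rewrite /b; ring.
rewrite invfM -!mulrA; congr (_ * _).
have := cGamma_neq0 ra0; move: (cGamma (rho + alpha)) => G G0.
by rewrite mulrCA mulKf.
Qed.

End SaigoPower.

(** * The k-Gamma function *)

Section KGamma.
Context {R : realType}.
Local Notation mR := (measurableTypeR R).

Lemma exhausts_image (D E : set mR) (a b : nat -> R) (h : R -> R) :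
  exhausts D a b -> {in D &, {homo h : s t / s < t}} ->
  (forall t, D t -> E (h t)) -> (forall u, E u -> exists2 t, D t & h t = u) ->
  (forall u v w, E u -> E w -> u <= v <= w -> E v) ->
  exhausts E (h \o a) (h \o b).
Proof.
move=> eD homo DE ED cE; have [ab ha hb DU] := eD.
have Da n : D (a n) by apply: (exhausts_sub (n := n) eD); rewrite lexx ltW.
have Db n : D (b n) by apply: (exhausts_sub (n := n) eD); rewrite lexx ltW.
have mono s t : D s -> D t -> s <= t -> h s <= h t.
  move=> Ds Dt; rewrite le_eqVlt => /predU1P[->//|st].
  by rewrite ltW// homo ?inE.
split => [n|m n mn|m n mn|]; rewrite /=.
- by apply: homo; rewrite ?inE.
- by apply: mono => //; exact: ha.
- by apply: mono => //; exact: hb.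
- apply/seteqP; split => u.
    move=> /ED[t]; rewrite {1}DU => -[n _ /=]; rewrite in_itv /= => tn <-.
    have Dt := exhausts_sub eD tn; have /andP[t1 t2] := tn.
    by exists n => //=; rewrite in_itv /= !mono.
  move=> [n _ /=]; rewrite in_itv /= => un.
  exact: (cE _ _ _ (DE _ (Da n)) (DE _ (Db n)) un).
Qed.

Lemma cintegrable_gamma (z : R[i]) : 0 < re z ->
  cintegrable `]0, +oo[ (fun t => cpow t (z - 1) * (expR (- t))%:C).
Proof.
move=> z0; apply: (cintegrable_le _ _ (integrable_gamma z0 ltr01)).
- exact: measurable_itv.
- apply: open_ccontinuous_cmeasurable; first exact: interval_open.
  move=> t /=; rewrite in_itv /= andbT => t0.
  apply: ccontinuousM; first exact: ccontinuous_cpow.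
  apply: ccontinuousC; apply: continuous_comp; last exact: continuous_expR.
  by apply: cvgN; exact: cvg_id.
- move=> t; rewrite /= in_itv /= andbT => t0.
  by rewrite normcM normc_cpow// normcC ger0_norm ?expR_ge0// mul1r reB re1.
Qed.

(** The substitution [u = t^k / k] in Euler's integral. *)
Lemma kGammaE (k : R) (z : R[i]) : 0 < k ->
  kGamma k z = cpow k (z / k%:C - 1) * cGamma (z / k%:C).
Proof.
move=> k0; rewrite /kGamma; case: ifPn => // z0.
have kC0 : k%:C != 0 :> R[i] by rewrite eq_complex /= gt_eqF.
have zk0 : 0 < re (z / k%:C).
  by rewrite -fmorphV reMr divr_gt0.
rewrite cGamma_euler//.
pose h (t : R) := t `^ k / k; pose h' (t : R) := t `^ (k - 1).
pose g (u : R) := cpow u (z / k%:C - 1) * (expR (- u))%:C.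
have pos (t : R) : `]0, +oo[%classic t = (0 < t) :> Prop.
  by rewrite /= in_itv /= andbT.
have oD : open (`]0, +oo[%classic : set R) by exact: interval_open.
have mD : measurable (`]0, +oo[%classic : set mR) by exact: measurable_itv.
have homo : {in `]0, +oo[%classic &, {homo h : s t / s < t}}.
  move=> s t /set_mem; rewrite pos => s0 /set_mem; rewrite pos => t0 st.
  by rewrite ltr_pM2r ?invr_gt0//; apply: gt0_ltr_powR; rewrite ?nnegrE ?ltW.
have eE : exhausts `]0, +oo[%classic (h \o (fun n => n.+2%:R^-1))
    (h \o (fun n => n.+2%:R)).
  apply: (exhausts_image exhausts_itv0y homo).
  - by move=> t; rewrite !pos => t0; rewrite divr_gt0 ?powR_gt0.
  - move=> u; rewrite pos => u0; exists ((u * k) `^ k^-1).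
      by rewrite pos powR_gt0// mulr_gt0.
    by rewrite /h -powRrM mulVf ?gt_eqF// powRr1 ?mulfK ?gt_eqF// ltW// mulr_gt0.
  - by move=> u v w; rewrite !pos => u0 _ /andP[uv _]; exact: lt_le_trans uv.
have [|||||ih e] := exhaust_csubstitution (g := g) (h := h) (h' := h') oD
  exhausts_itv0y oD eE homo.
- move=> t; rewrite pos => t0.
  apply: (is_derive_eq (is_deriveM (is_derive_powR k t0) (is_derive_cst k^-1 t 1))).
  by rewrite /GRing.scale /= mulr0 add0r mulrA mulVf ?mul1r// gt_eqF.
- by move=> t; rewrite pos; exact: continuous_powR.
- by move=> t _; exact: powR_ge0.
- move=> u; rewrite pos => u0; apply: ccontinuousM; first exact: ccontinuous_cpow.
  apply: ccontinuousC; apply: continuous_comp; last exact: continuous_expR.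
  by apply: cvgN; exact: cvg_id.
- exact: cintegrable_gamma.
rewrite /euler_integral -/g -e -(cintegralZ _ mD ih).
apply: eq_cintegral => t /set_mem; rewrite pos => t0.
rewrite /g /h /h' cpow_div ?powR_gt0// cpow_powR// -cpow_real// rmorphB.
have -> : z - 1 = (z / k%:C - 1) * k%:C + (k%:C - 1) by field.
rewrite (cpowD t (_ * _)); have := cpow_neq0 k (z / k%:C - 1).
by move: (cpow k _) => c c0; field.
Qed.

End KGamma.


(** * The k-Bessel series *)

Section BesselSeries.
Context {R : realType}.
Implicit Types (z v : R[i]) (k c x t y : R).

Lemma exp_partial_sum_le y n : 0 <= y ->
  \sum_(0 <= i < n) y ^+ i / i`!%:R <= expR y.
Proof.
move=> y0; rewrite -[leLHS]/(series (exp_coeff y) n).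
apply: nondecreasing_cvgn_le; last exact: is_cvg_series_exp_coeff.
by apply/nondecreasing_series => i _ _; exact: exp_coeff_ge0.
Qed.

(** As soon as [1 <= Re z + n], the functional equation expresses the next
    reciprocal as the previous one divided by a number of modulus at least 1. *)
Lemma cGammaV_bounded z : exists2 C, 0 < C &
  forall n, normc (cGamma (z + n%:R))^-1 <= C.
Proof.
pose N := (Num.truncn (- re z)).+3.
pose u n := normc (cGamma (z + n%:R))^-1.
exists (1 + \sum_(0 <= j < N) u j).
  by rewrite ltr_pwDl// sumr_ge0// => j _; exact: normc_ge0.
have small n : (n < N)%N -> u n <= 1 + \sum_(0 <= j < N) u j.
  move=> nN; rewrite (bigD1_seq n) ?mem_index_iota ?iota_uniq//= addrCA lerDl.
  by rewrite addr_ge0// sumr_ge0// => j _; exact: normc_ge0.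
elim=> [|n IH]; first exact: small.
have [nN|Nn] := ltnP n.+1 N; first exact: small.
apply: le_trans IH; rewrite [leRHS](_ : _ = normc (z + n%:R) * u n.+1).
  rewrite ler_peMl ?normc_ge0//; apply: le_trans (normc_re _).
  apply: (le_trans _ (ler_norm _)); rewrite reD re_nat -lerBlDl.
  have := truncnS_gt (- re z); have : (Num.truncn (- re z)).+2%:R <= n%:R :> R.
    by rewrite ler_nat.
  rewrite -(natr1 (Num.truncn (- re z)).+1).
  by move: ((Num.truncn (- re z)).+1%:R : R) => y; lra.
have e := cGammaV_rec (z + n%:R); rewrite -addrA natr1 in e.
by rewrite -normcM; congr normc.
Qed.

(** The coefficient of [t^(2n + v/k)] in the k-Bessel series. *)
Definition bessel_coef k c v n : R[i] :=
  (- c%:C) ^+ n / (kGamma k (n%:R * k%:C + v + k%:C) * n`!%:R) /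
  cpow 2 (2 * n%:R + v / k%:C).

Lemma bessel_coefE k c v n : 0 < k ->
  bessel_coef k c v n =
  (cGamma (v / k%:C + 1 + n%:R))^-1 / cpow (2 * k) (v / k%:C) *
  ((- (c / (4 * k)))%:C ^+ n / n`!%:R).
Proof.
move=> k0; have kC0 : k%:C != 0 :> R[i] by rewrite eq_complex /= gt_eqF.
rewrite /bessel_coef kGammaE//.
have -> : (n%:R * k%:C + v + k%:C) / k%:C = v / k%:C + 1 + n%:R by field.
have -> : v / k%:C + 1 + n%:R - 1 = n%:R + v / k%:C by ring.
rewrite cpowM// !cpowD cpow_nat// -[2 * n%:R]natrM cpow_nat// exprM.
have -> : (- (c / (4 * k)))%:C = - c%:C / (4 * k%:C) :> R[i].
  by rewrite rmorphN fmorph_div rmorphM rmorph_nat mulNr.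
have -> : ((2 ^+ 2) ^+ n)%:C = 4 ^+ n :> R[i].
  by rewrite -exprM rmorphXn rmorph_nat exprM -natrX.
rewrite rmorphXn /= exprMn exprVn exprMn.
have : k%:C ^+ n != 0 by rewrite expf_neq0.
have : 4 ^+ n != 0 :> R[i] by rewrite expf_neq0// pnatr_eq0.
have : n`!%:R != 0 :> R[i] by rewrite pnatr_eq0 -lt0n fact_gt0.
have := cpow_neq0 (2 : R) (v / k%:C); have := cpow_neq0 k (v / k%:C).
rewrite !invfM.
move: (cpow 2 _) (cpow k _) (n`!%:R : R[i]) (4 ^+ n) (k%:C ^+ n) ((cGamma _)^-1)
  => c2 ck F f p G ck0 c20 F0 f0 p0.
by field; rewrite ck0 c20 F0 f0 p0.
Qed.

Lemma bessel_coef_le k c v : 0 < k -> exists2 C, 0 < C &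
  forall n, normc (bessel_coef k c v n) <= C * (`|c / (4 * k)| ^+ n / n`!%:R).
Proof.
move=> k0; have [C C0 HC] := cGammaV_bounded (v / k%:C + 1).
have P0 : 0 < normc (cpow (2 * k) (v / k%:C)) by rewrite normc_gt0 cpow_neq0.
exists (C / normc (cpow (2 * k) (v / k%:C))) => [|n]; first exact: divr_gt0.
rewrite bessel_coefE// normcM !normc_div normcX normcC normrN normc_nat.
apply: ler_wpM2r; first by rewrite divr_ge0// exprn_ge0.
by apply: ler_wpM2r; rewrite ?invr_ge0 ?normc_ge0.
Qed.

Lemma bessel_coef_series_le k c v x : 0 < k -> 0 < x -> exists M,
  forall n, \sum_(0 <= i < n) normc (bessel_coef k c v i) * x ^+ (2 * i) <= M.
Proof.
move=> k0 x0; have [C C0 HC] := bessel_coef_le c v k0.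
exists (C * expR (`|c / (4 * k)| * x ^+ 2)) => n.
have y0 : 0 <= `|c / (4 * k)| * x ^+ 2 by rewrite mulr_ge0 ?sqr_ge0.
apply: (le_trans _ (ler_wpM2l (ltW C0) (exp_partial_sum_le n y0))).
rewrite mulr_sumr; apply: ler_sum => i _.
apply: (le_trans (ler_wpM2r _ (HC i))); first by rewrite exprn_ge0// ltW.
by rewrite exprMn -exprM -!mulrA [_ * x ^+ _]mulrC.
Qed.

Lemma kBessel_cvg k c v t : 0 < k -> 0 < t ->
  ccvg (series (fun n => bessel_coef k c v n * cpow t (2 * n%:R + v / k%:C)))
       (kBessel k c v t).
Proof.
move=> k0 t0; have [M HM] := bessel_coef_series_le c v k0 t0.
have -> : kBessel k c v t =
    csum (fun n => bessel_coef k c v n * cpow t (2 * n%:R + v / k%:C)).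
  rewrite /kBessel; congr csum; apply/funext => n.
  by rewrite cpow_div// /bessel_coef mulrA mulrAC.
apply: normc_series_cvg.
apply: (nneg_series_cvg (M := M * t `^ re (v / k%:C))) => n.
  exact: normc_ge0.
apply: (le_trans _ (ler_wpM2r (powR_ge0 _ _) (HM n))).
rewrite /series /= mulr_suml le_eqVlt; apply/orP; left; apply/eqP.
apply: eq_bigr => i _; rewrite (normcM (bessel_coef k c v i)) cpowD.
rewrite -[2 * _]natrM cpow_nat// (normcM (t ^+ (2 * i))%:C) normc_cpow//.
by rewrite normcC ger0_norm ?mulrA// exprn_ge0// ltW.
Qed.

End BesselSeries.

Theorem theorem2p1 (R : realType) (k c x : R) (alpha beta eta lambda v : R[i])
    (k_gt0 : 0 < k) (x_gt0 : 0 < x)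
    (v_gt : -1 < complex.Re v)
    (alpha_gt0 : 0 < complex.Re alpha)
    (lambdav_gt : Num.max 0 (complex.Re (beta - eta)) < complex.Re (lambda + v))
    (* for k <= 1 this adds nothing; for k > 1 the integral may diverge at 0
       without it *)
    (lambdavk_gt : 1 < k ->
       complex.Re (beta - eta) < complex.Re ((lambda + v) / k%:C)) :
  let K := k%:C in
  let f := fun t : R => cpow t (lambda / K - 1) * kBessel k c v t in
  saigo_converges alpha beta eta f x /\
  saigo alpha beta eta f x =
    cpow x (lambda / K + v / K - beta - 1) / cpow (2 * k) (v / K)
    * wright
        [:: (lambda / K + v / K, 2); (lambda / K + v / K + eta - beta, 2)]
        [:: (lambda / K + v / K - beta, 2);
            (lambda / K + v / K + alpha + eta, 2);
            (v / K + 1, 1)]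
        (- (c * x ^+ 2 / (4 * k)))%:C.
Proof.
move=> K f.
pose nu := v / K; pose rho n : R[i] := lambda / K + nu + 2 * n%:R.
have mD : measurable (`]0, x[%classic : set (measurableTypeR R)).
  exact: measurable_itv.
have /andP[lv0 lvb] : (0 < re (lambda + v)) && (re (beta - eta) < re (lambda + v)).
  by move: lambdav_gt; rewrite gt_max.
have r0E : re (lambda / K + nu) = re (lambda + v) / k.
  by rewrite /nu -mulrDl /K -fmorphV reMr.
have r00 : 0 < re (lambda / K + nu) by rewrite r0E divr_gt0.
(* for k <= 1, division by k increases the positive number Re (lambda + v) *)
have r0b : re (beta - eta) < re (lambda / K + nu).
  have [k1|k1] := ltP 1 k; first by rewrite /nu -mulrDl; exact: lambdavk_gt.
  by apply: (lt_le_trans lvb); rewrite r0E ler_pdivlMr// ler_piMr// ltW.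
have rn n : re (rho n) = re (lambda / K + nu) + (2 * n)%:R.
  by rewrite /rho reD -natrM re_nat.
have rho0 n : 0 < re (rho n) by rewrite rn ltr_wpDr.
have rhob n : 0 < re (rho n + eta - beta).
  have := ler0n R (2 * n).
  by move: r0b; rewrite !reB (reD (rho n)) rn; lra.
pose S n := saigo_integrand alpha beta eta (fun t => cpow t (rho n - 1)) x.
have SI n : cintegrable `]0, x[ (S n) /\ cintegral `]0, x[ (S n) = _ :=
  saigo_kernel_power x_gt0 alpha_gt0 (rho0 n) (rhob n).
have Sn n t : 0 < t -> S n t = S 0%N t * (t ^+ (2 * n))%:C.
  move=> t0; rewrite /S /saigo_integrand -[RHS]mulrA; congr (_ * _).
  rewrite -cpow_nat// -cpowD; congr cpow.
  by rewrite /rho mulr0 natrM; ring.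
pose u n t := bessel_coef k c v n * S n t.
have ui n : cintegrable `]0, x[ (u n) by apply: cintegrableZ => //; exact: (SI n).1.
have cu t : `]0, x[%classic t ->
    ccvg (series (fun n => u n t)) (saigo_integrand alpha beta eta f x t).
  move=> /itv0xP/andP[t0 tx]; rewrite /saigo_integrand /f.
  have := ccvgZ (cpow (x - t) (alpha - 1) * hyp2F1 (alpha + beta) (- eta) alpha
    (1 - t / x)%:C * cpow t (lambda / K - 1)) (kBessel_cvg c v k_gt0 t0).
  rewrite -[X in ccvg _ X]mulrA; apply: ccvg_near; apply: nearW => n.
  rewrite /series /= mulr_sumr; apply: eq_bigr => i _.
  rewrite /u /S /saigo_integrand.
  have -> : rho i - 1 = (lambda / K - 1) + (2 * i%:R + v / k%:C).
    by rewrite /rho /nu; ring.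
  rewrite (cpowD t (lambda / K - 1)); ring.
have [M HM] := bessel_coef_series_le c v k_gt0 x_gt0.
(* on ]0, x[ the n-th power integrand is at most x^(2n) times the 0-th one *)
pose I0 := \int[@lebesgue_measure R]_(t in `]0, x[) normc (S 0%N t).
have uM n : \sum_(0 <= i < n) \int[@lebesgue_measure R]_(t in `]0, x[) normc (u i t)
    <= M * I0.
  have I0_ge0 : 0 <= I0 by apply: Rintegral_ge0 => t _; exact: normc_ge0.
  apply: (le_trans _ (ler_wpM2r I0_ge0 (HM n))); rewrite mulr_suml.
  apply: ler_sum => i _.
  have iS := cintegrable_normc mD (SI 0%N).1.
  rewrite -RintegralZl//; apply: le_Rintegral => //.
  - by apply: cintegrable_normc.
  - exact: (integrableZl mD (normc (bessel_coef k c v i) * x ^+ (2 * i)) iS).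
  - move=> t /itv0xP/andP[t0 tx].
    rewrite /u (normcM (bessel_coef k c v i)) (Sn i t t0) (normcM (S 0%N t)).
    rewrite normcC ger0_norm ?exprn_ge0 ?(ltW t0)//.
    rewrite -mulrA; apply: ler_wpM2l; first exact: normc_ge0.
    rewrite mulrC; apply: ler_wpM2r; first exact: normc_ge0.
    by apply: lerXn2r; rewrite ?nnegrE ltW.
have [iF cF] := cintegral_series mD ui uM cu.
split=> //.
set pre := _ / cpow (2 * k) _.
have pre0 : pre != 0 by rewrite mulf_neq0 ?invr_neq0 ?cpow_neq0.
apply: (mulfI (invr_neq0 pre0)); rewrite [RHS]mulrA mulVf// mul1r.
apply/esym/csumE.
have -> : pre^-1 * saigo alpha beta eta f x =
    pre^-1 * (cpow x (- alpha - beta) / cGamma alpha) *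
    cintegral `]0, x[ (saigo_integrand alpha beta eta f x).
  by rewrite -[RHS]mulrA.
apply: ccvg_near (ccvgZ _ cF).
apply: nearW => n; rewrite /series /= mulr_sumr; apply: eq_bigr => i _.
rewrite cintegralZ//; last exact: (SI i).1.
rewrite (SI i).2 bessel_coefE// /wright_term.
rewrite big_cons big_seq1 2!big_cons big_seq1 /=.
have c2 : 2%:C = 2 :> R[i] by rewrite natC.
have c1 : 1%:C = 1 :> R[i] by [].
rewrite c2 c1 (mul1r i%:R).
have -> : lambda / K + v / K + 2 * i%:R = rho i by [].
have -> : lambda / K + v / K + eta - beta + 2 * i%:R = rho i + eta - beta.
  by rewrite /rho /nu; ring.
have -> : lambda / K + v / K - beta + 2 * i%:R = rho i - beta.
  by rewrite /rho /nu; ring.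
have -> : lambda / K + v / K + alpha + eta + 2 * i%:R = rho i + alpha + eta.
  by rewrite /rho /nu; ring.
have -> : cpow x (rho i + alpha - 1) = cpow x (lambda / K + v / K - beta - 1) *
    cpow x (alpha + beta) * (x ^+ (2 * i))%:C.
  by rewrite -cpow_nat// -!cpowD natrM; congr cpow; rewrite /rho /nu; ring.
have -> : (- (c * x ^+ 2 / (4 * k)))%:C ^+ i =
    (- (c / (4 * k)))%:C ^+ i * (x ^+ (2 * i))%:C :> R[i].
  rewrite exprM [(_ ^+ i)%:C]rmorphXn -exprMn -rmorphM; congr (_%:C ^+ _).
  by ring.
have -> : - alpha - beta = - (alpha + beta) by ring.
rewrite cpowN /pre -/K !invfM !invrK.
have := cGamma_neq0 alpha_gt0; have := cpow_neq0 x (alpha + beta).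
have := cpow_neq0 x (lambda / K + v / K - beta - 1).
have := cpow_neq0 (2 * k) (v / K).
move: ((cGamma (rho i - beta))^-1) ((cGamma (rho i + alpha + eta))^-1)
  ((cGamma (v / K + 1 + i%:R))^-1) (cGamma alpha) (cGamma (rho i))
  (cGamma (rho i + eta - beta)) (cpow x (alpha + beta)) (cpow (2 * k) _)
  (cpow x _) ((- (c / (4 * k)))%:C ^+ i) ((x ^+ (2 * i))%:C) (i`!%:R^-1 : R[i])
  => G1 G2 G3 Ga G4 G5 p1 p2 p3 C X F p20 p30 p10 Ga0.
by field; rewrite p20 p30 p10 Ga0.
Qed.
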